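(* Let $\tilde f_i\in L^2((0,L_i);\mathbb{R}^3)$ and $\tilde F_i\in\mathbb{R}^3$, $i=1,\dots,n$, satisfy $\sum_{i=1}^n\big(\int_0^{L_i}\tilde f_i\,dx_1+\tilde F_i\big)=0$, and put $\tilde p_i(x_1)=\int_{x_1}^{L_i}\tilde f_i(z)\,dz+\tilde F_i$. Consider on $$\mathcal{R}=\Big\{R=(R_1,\dots,R_n)\in\prod_{i=1}^nW^{1,2}((0,L_i);\mathrm{SO}(3)):\ R_1(0)Q_1^T=\cdots=R_n(0)Q_n^T\Big\}$$ the functional $$\tilde J(R)=\sum_{i=1}^n\Big(\frac12\int_0^{L_i}q_2^i(R_i^TR_i')\,dx_1-\int_0^{L_i}\tilde p_i\cdot R_ie_1\,dx_1\Big).$$ Let $R\in\mathcal{R}$ be a stationary point of $\tilde J$ over $\mathcal{R}$, i.e. $$\frac{d}{d\varepsilon}\tilde J\big(e^{\varepsilon A_{v_1}}R_1,\dots,e^{\varepsilon A_{v_n}}R_n\big)\Big|_{\varepsilon=0}=0$$ for all $(v_1,\dots,v_n)\in\prod_{i=1}^nC^\infty([0,L_i];\mathbb{R}^3)$ with $v_1(0)=\cdots=v_n(0)$, and let $y_i$ be determined by $y_i'=R_ie_1$, $y_i(0)=y_0$, $i=1,\dots,n$, with a constant $y_0\in\mathbb{R}^3$. Let $s_i\in L^2((0,L_i);\mathbb{R}^3)$ be the axial vector of $R_i^TR_i'$, i.e. $R_i^TR_i'=A_{s_i}$, and set $\tilde s_i=R_is_i$, $\tilde q_i=R_iH_iR_i^T\tilde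 s_i$. Then, for $i=1,\dots,n$, $$\tilde p_i'+\tilde f_i=0,\quad \tilde p_i(L_i)=\tilde F_i,$$ $$\tilde q_i'+R_ie_1\times\tilde p_i=0,\quad \tilde q_i(L_i)=0,$$ $$\tilde q_i=R_iH_iR_i^T\tilde s_i,\qquad R_i'=A_{\tilde s_i}R_i,\qquad y_i'=R_ie_1,$$ together with the junction conditions $$\sum_{i=1}^n\tilde p_i(0)=0,\qquad\sum_{i=1}^n\tilde q_i(0)=0,$$ $$R_1(0)Q_1^T=\cdots=R_n(0)Q_n^T,\qquad y_1(0)=\cdots=y_n(0).$$
   Context: Data: $n\in\mathbb{N}$, $L_i>0$, $Q_i\in\mathrm{SO}(3)$, and $S_i\subset\mathbb{R}^2$ open, bounded, connected (Lipschitz) sets with $\int_{S_i}x_2x_3\,dx_2dx_3=\int_{S_i}x_2\,dx_2dx_3=\int_{S_i}x_3\,dx_2dx_3=0$, for $i=1,\dots,n$. $\mathbb{M}^{3\times3}$ denotes real $3\times3$ matrices and $\mathbb{M}^{3\times3}_{skew}$ the skew-symmetric ones; $\operatorname{dist}$ is the Frobenius distance. $W:\mathbb{M}^{3\times3}\to[0,+\infty]$ satisfies: $W\in C^0(\mathbb{M}^{3\times3})$ and $W$ is $C^2$ in a neighborhood of $\mathrm{SO}(3)$; $W(F)=W(RF)$ for all $F\in\mathbb{M}^{3\times3}$, $R\in\mathrm{SO}(3)$; $W(F)\ge C_W\operatorname{dist}^2(F,\mathrm{SO}(3))$ with a constant $C_W>0$, and $W(F)=0$ if $F\in\mathrm{SO}(3)$.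 For $A\in\mathbb{M}^{3\times3}_{skew}$, $$q_2^i(A)=\min_{\alpha\in W^{1,2}(S_i;\mathbb{R}^3)}\int_{S_i}q_3^i\left(A\begin{pmatrix}0\\ x_2\\ x_3\end{pmatrix}\Big|\,\partial_2\alpha\,\Big|\,\partial_3\alpha\right)dx_2dx_3,\qquad q_3^i(G)=\frac{\partial^2W}{\partial F^2}(Q_i^T)(GQ_i^T,GQ_i^T);$$ $q_2^i$ is a positive definite quadratic form of $A$. For $s\in\mathbb{R}^3$, $A_s$ is the skew-symmetric matrix with $A_sx=s\times x$ for all $x\in\mathbb{R}^3$. $H_i$ is the symmetric positive definite $3\times3$ matrix with $q_2^i(A_s)=H_is\cdot s$ for all $s\in\mathbb{R}^3$. $W^{1,2}((0,L_i);\mathrm{SO}(3))$ is the set of $R\in W^{1,2}((0,L_i);\mathbb{R}^{3\times3})$ with values in $\mathrm{SO}(3)$ a.e. Differential equations hold a.e. on $(0,L_i)$, and values at $0$ and $L_i$ are in the sense of traces. *)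

(* Defs.v *)
From mathcomp Require Export all_boot all_order all_algebra.
From mathcomp Require Export all_classical all_reals all_analysis.
Export numFieldNormedType.Exports.
Export Order.TTheory GRing.Theory Num.Theory.

Set Implicit Arguments.
Unset Strict Implicit.
Unset Printing Implicit Defensive.

Local Open Scope classical_set_scope.
Local Open Scope ring_scope.

(* Measurable means Borel measurable throughout: every L^2 class has a Borel
   representative, and all the notions below depend only on classes modulo
   null sets. *)

Section linear_algebra.
Context {R : realType}.
Implicit Types u v s : 'cV[R]_3.

Definition SO3 : set 'M[R]_3 := [set Q | Q^T *m Q = 1%:M /\ \det Q = 1].

Definition frobenius (F : 'M[R]_3) : R :=
  Num.sqrt (\sum_i \sum_j (F i j) ^+ 2).

Definition dist_SO3 (F : 'M[R]_3) : R := inf [set frobenius (F - Q) | Q in SO3].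

Definition e1 : 'cV[R]_3 := delta_mx 0 0.

Definition dot u v : R := \sum_k u k 0 * v k 0.

(* Indices are added in 'I_3, that is modulo 3. *)
Definition cross u v : 'cV[R]_3 :=
  \col_k (u (k + 1) 0 * v (k + 2) 0 - u (k + 2) 0 * v (k + 1) 0).

(* A_s: its j-th column is s x e_j. *)
Definition axial_mx s : 'M[R]_3 := \matrix_(i, j) cross s (delta_mx j 0) i 0.

Lemma axial_mxE s x : axial_mx s *m x = cross s x.
Proof.
have dE (l j : 'I_3) : (delta_mx j 0 : 'cV[R]_3) l 0 = (l == j)%:R by rewrite mxE andbT.
apply/colP => k; rewrite !mxE.
under eq_bigr do rewrite !mxE !andbT mulrBl -!mulrA.
rewrite big_split /= sumrN.
rewrite (bigD1 (k + 2)) //= eqxx mul1r big1 ?addr0; last first.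
  by move=> j /negPf nj; rewrite eq_sym nj mul0r mulr0.
rewrite (bigD1 (k + 1)) //= eqxx mul1r big1 ?addr0 //.
by move=> j /negPf nj; rewrite eq_sym nj mul0r mulr0.
Qed.

Definition mexp (A : 'M[R]_3) : 'M[R]_3 :=
  limn (series (fun k => (k`!%:R^-1 : R) *: A ^+ k)).

End linear_algebra.

Section smooth.
Context {R : realType} {V W : normedModType R}.

(* f is of class C^k on the open set U (V is meant to be finite-dimensional):
   all directional derivatives of order at most k exist and are continuous. *)
Fixpoint Ck_on (U : set V) (k : nat) (f : V -> W) : Prop :=
  (forall x, U x -> {for x, continuous f}) /\
  if k is j.+1 then
    forall v, (forall x, U x -> derivable f x v) /\ Ck_on U j ('D_v f)
  else True.

Definition smooth (f : V -> W) : Prop := forall k, Ck_on setT k f.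

End smooth.

(* C_c^oo(Om) *)
Definition test_function {R : realType} {V : normedModType R}
    (Om : set V) (phi : V -> R) : Prop :=
  [/\ smooth phi, compact (closure [set x | phi x != 0]) &
      closure [set x | phi x != 0] `<=` Om].

Definition square_integrable {d} {T : measurableType d} {R : realType}
    (mu : {measure set T -> \bar R}) (D : set T) {m n} (u : T -> 'M[R]_(m, n)) :=
  forall i j, measurable_fun D (fun t => u t i j) /\
    (\int[mu]_(t in D) ((u t i j) ^+ 2)%:E < +oo)%E.

Section interval_sobolev.
Context {R : realType}.
Local Notation mu := (@lebesgue_measure R).
Implicit Types L : R.

Definition int1 (D : set R) (f : R -> R) : R := \int[mu]_(t in D) f t.

Definition L2 L {m n} (u : R -> 'M[R]_(m, n)) : Prop :=
  square_integrable mu `]0, L[ u.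

Definition ae_on L (P : R -> Prop) : Prop :=
  {ae mu, forall t, `]0, L[%classic t -> P t}.

Definition is_weak_deriv L {m n} (u g : R -> 'M[R]_(m, n)) : Prop :=
  [/\ L2 L u, L2 L g & forall phi : R -> R, test_function `]0, L[ phi ->
    forall i j, int1 `]0, L[ (fun t => u t i j * derive1 phi t) =
              - int1 `]0, L[ (fun t => g t i j * phi t)].

Definition W12 L {m n} (u : R -> 'M[R]_(m, n)) : Prop :=
  exists g, is_weak_deriv L u g.

(* A representative of the weak derivative. *)
Definition weak_deriv L {m n} (u : R -> 'M[R]_(m, n)) : R -> 'M[R]_(m, n) :=
  xget (fun=> 0) [set g | is_weak_deriv L u g].

(* The trace at x (x = 0 or L) of u in W^{1,2}(0, L) is the value at x of the
   representative of u that is continuous on [0, L]. *)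
Definition trace L {m n} (u : R -> 'M[R]_(m, n)) (x : R) : 'M[R]_(m, n) :=
  xget 0 [set a | exists w : R -> 'M[R]_(m, n),
    [/\ {within `[0, L], continuous w}, ae_on L (fun t => w t = u t) & w x = a]].

Definition W12_SO3 L (u : R -> 'M[R]_3) : Prop :=
  W12 L u /\ ae_on L (fun t => SO3 (u t)).

Definition vint (D : set R) (f : R -> 'cV[R]_3) : 'cV[R]_3 :=
  \col_k int1 D (fun t => f t k 0).

End interval_sobolev.

Section cross_section.
Context {R : realType}.
Local Notation mu2 := (@lebesgue_measure R \x @lebesgue_measure R)%E.
Implicit Types S : set (R * R).

(* Near each boundary point and in suitable orthonormal coordinates (a, b), the
   open set S is the region above the graph of a Lipschitz function. *)
Definition lipschitz_boundary S : Prop :=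
  forall x : R * R, closure S x -> ~ S x ->
  exists (c s r : R) (gamma : R -> R),
    [/\ c ^+ 2 + s ^+ 2 = 1, 0 < r, lipschitz gamma &
     forall a b, `|a| < r -> `|b| < r ->
       S (x.1 + c * a - s * b, x.2 + s * a + c * b) <-> gamma a < b].

Definition int2 S (f : R * R -> R) : R := \int[mu2]_(x in S) f x.

Definition cross_section S : Prop :=
  [/\ open S, bounded_set S, connected S & lipschitz_boundary S] /\
  [/\ int2 S (fun x => x.1 * x.2) = 0, int2 S (fun x => x.1) = 0 &
      int2 S (fun x => x.2) = 0].

Definition is_weak_partial S (v : R * R) {m n} (u g : R * R -> 'M[R]_(m, n)) :=
  [/\ square_integrable mu2 S u, square_integrable mu2 S g &
    forall phi : R * R -> R, test_function S phi ->
    forall i j, int2 S (fun x => u x i j * 'D_v phi x) =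
              - int2 S (fun x => g x i j * phi x)].

End cross_section.

Section energy.
Context {R : realType}.

Definition energy_density (W : 'M[R]_3 -> \bar R) : Prop :=
  [/\ forall F, (0 <= W F)%E,
      continuous W,
      exists U : set 'M[R]_3, [/\ open U, SO3 `<=` U,
        forall F, U F -> W F \is a fin_num & Ck_on U 2 (fine \o W)] &
      [/\ forall F Q, SO3 Q -> W (Q *m F) = W F,
      exists2 CW : R, 0 < CW & forall F, ((CW * dist_SO3 F ^+ 2)%:E <= W F)%E &
      forall F, SO3 F -> W F = 0%E]].

Context (W : 'M[R]_3 -> \bar R) (Q : 'M[R]_3).

(* The second derivative of W at Q^T, on the diagonal, as an iterated
   directional derivative. *)
Definition q3 (G : 'M[R]_3) : R :=
  let w : 'M[R]_3 -> R := fine \o W in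
  let K := G *m Q^T in 'D_K ('D_K w) Q^T.

(* x = (x_2, x_3), and g2, g3 are the weak partial derivatives of alpha in
   W^{1,2}(S; R^3). When the minimum over alpha is attained it is this inf. *)
Definition q2 (S : set (R * R)) (A : 'M[R]_3) : R :=
  inf [set r | exists alpha g2 g3 : R * R -> 'cV[R]_3,
    [/\ is_weak_partial S (1, 0) alpha g2, is_weak_partial S (0, 1) alpha g3 &
        r = int2 S (fun x =>
              let X : 'cV[R]_3 := \col_k nth 0 [:: 0; x.1; x.2] k in
              q3 (row_mx (A *m X) (row_mx (g2 x) (g3 x))))]].

End energy.

Section rods.
Context {R : realType} (n : nat) (L : 'I_n -> R) (Q : 'I_n -> 'M[R]_3).
Implicit Type rot : 'I_n -> R -> 'M[R]_3.

Definition admissible rot : Prop :=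
  (forall i, W12_SO3 (L i) (rot i)) /\
  (forall i j, trace (L i) (rot i) 0 *m (Q i)^T =
               trace (L j) (rot j) 0 *m (Q j)^T).

Context (W : 'M[R]_3 -> \bar R) (S : 'I_n -> set (R * R)).
Context (p : 'I_n -> R -> 'cV[R]_3).

Definition rod_energy rot : R :=
  \sum_i (2^-1 * int1 `]0, L i[ (fun t =>
             q2 W (Q i) (S i) ((rot i t)^T *m weak_deriv (L i) (rot i) t))
          - int1 `]0, L i[ (fun t => dot (p i t) (rot i t *m e1))).

(* C^oo([0, L_i]) consists of the restrictions to [0, L_i] of smooth functions
   on the whole line. *)
Definition stationary rot : Prop :=
  forall v : 'I_n -> R -> 'cV[R]_3,
    (forall i, smooth (v i)) -> (forall i j, v i 0 = v j 0) ->
    is_derive (0 : R) (1 : R)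
      (fun eps : R =>
         rod_energy (fun i t => mexp (eps *: axial_mx (v i t)) *m rot i t)) 0.

End rods.

(* Main.v *)
Require Import Defs.
From mathcomp Require Import ring lra measurable_realfun.

Set Implicit Arguments.
Unset Strict Implicit.
Unset Printing Implicit Defensive.

Local Open Scope classical_set_scope.
Local Open Scope ring_scope.

(** The equations for the force p hold because p is defined as the tail integral
    of f plus the end load, and the kinematic equations are the definition of the
    axial vector s transported by R. The content is the moment balance, which is
    the Euler-Lagrange system of the energy.

    Stationarity is used only along rotations of rod i about a fixed axis e_k by
    the angle eps * phi_i. By Rodrigues' formula (mexp_rotation) the strain of the
    rotated rod is s + eps phi_i' R^T e_k (variation_strain), so the energy is a
    quadratic polynomial in eps plus a remainder of order eps^2 coming from the
    loads (rod_expansion). The vanishing of its first-order coefficient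
    (weak_euler_lagrange) reads

      sum_i (int phi_i' (R_i H_i s_i)_k - int phi_i (R_i e1 x p_i)_k) = 0

    for all smooth phi_i with a common value at 0. Let K_i(t) be the integral of
    R_i e1 x p_i over (t, L_i).

    - Taking every phi_i equal to 1 gives sum_i K_i(0) = 0 (sum_torque0).
    - Taking one phi_i to be a primitive, zero at 0, of an arbitrary test function
      and the others zero, integration by parts (fubini_tail) and the fundamental
      lemma of the calculus of variations give R_i H_i s_i = K_i almost everywhere
      (moment_tail).

    Since K_i is continuous on [0, L_i], it is the representative that computes the
    traces of q_i: it vanishes at L_i, its weak derivative is - R_i e1 x p_i, and the
    sum of its values at 0 is zero.

    The weak derivative of the rotated rod comes from the Leibniz rule for smooth
    multipliers (weak_der_mul). Multipliers, test functions and their primitives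
    all belong to a class of functions closed under differentiation (smooth_expr),
    which gives their smoothness. *)

(** * Smooth functions of one variable *)

Section flat.
Context {R : realType}.

(** Polynomials in 1/x times exp(-1/x), glued to 0 on the left. The polynomial
    factor makes the family stable under differentiation, so one computation of
    a derivative gives all orders at once. *)
Definition flat (P : {poly R}) (x : R) : R :=
  if 0 < x then P.[x^-1] * expR (- x^-1) else 0.

(** With y = 1/x, the exponential series gives y^(k+1) <= (k+1)! exp y, hence
    y^k exp(-y) <= (k+1)! x for each monomial of P. *)
Lemma flat_bound (P : {poly R}) : exists2 C, 0 <= C & forall x, `|flat P x| <= C * `|x|.
Proof.
exists (\sum_(k < size P) `|P`_k| * k.+1`!%:R).
  by apply: sumr_ge0 => k _; rewrite mulr_ge0.
move=> x; rewrite /flat; case: ifPn => [x0|_]; last first.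
  rewrite normr0 mulr_ge0 //; by apply: sumr_ge0 => k _; rewrite mulr_ge0.
have y0 : 0 < x^-1 by rewrite invr_gt0.
rewrite normrM (ger0_norm (expR_ge0 _)) (gtr0_norm x0) horner_coef.
rewrite expRN ler_pdivrMr ?expR_gt0// -mulrA.
apply: le_trans (ler_norm_sum _ _ _) _; rewrite mulr_suml.
apply: ler_sum => k _; rewrite normrM -mulrA ler_wpM2l//.
rewrite normrX (gtr0_norm y0).
have := expR_ge1Dxn k (ltW y0).
set y := x^-1 in y0 *; have -> : x = y^-1 by rewrite invrK.
move=> h; have {}h : y ^+ k.+1 / k.+1`!%:R <= expR y by lra.
rewrite ler_pdivrMr ?ltr0n ?fact_gt0// in h.
have yn : y != 0 by rewrite gt_eqF.
by rewrite [leRHS](_ : _ = (expR y * k.+1`!%:R) / y) ?ler_pdivlMr// -?exprSr//; field.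
Qed.

(** At 0 the difference quotient of flat P is flat ('X * P), which tends to 0 by
    the linear bound above; elsewhere this is the chain rule. *)
Lemma is_derive_flat (P : {poly R}) (x : R) :
  is_derive x 1 (flat P) (flat ('X^2 * (P - P^`())) x).
Proof.
have [x0|x0|x0] := ltgtP x 0; last 1 first.
- rewrite x0 /flat ltxx.
  have [C C0 hC] := flat_bound ('X * P).
  have lim0 : h^-1 *: (flat P (h *: 1 + 0) - flat P 0) @[h --> 0^'] --> (0 : R).
    apply/cvgr0Pnorm_le => e e0.
    near=> h.
    have -> : h^-1 *: (flat P (h *: 1 + 0) - flat P 0) = flat ('X * P) h.
      rewrite addr0 /flat ltxx subr0.
      have -> : h *: (1 : R) = h by rewrite /GRing.scale /= mulr1.
      rewrite /GRing.scale /=; case: ifPn => _; last by rewrite mulr0.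
      by rewrite hornerM hornerX mulrA.
    apply: le_trans (hC _) _.
    have : `|h| <= e / (C + 1).
      near: h; apply: dnbhs0_le; rewrite divr_gt0//; lra.
    rewrite ler_pdivlMr; last lra.
    move=> h1; apply: le_trans h1; rewrite mulrC ler_wpM2l//; lra.
  by apply: DeriveDef; [exact: (cvgP _ lim0)|exact: cvg_lim].
- have -> : flat ('X^2 * (P - P^`())) x = 0 by rewrite /flat ltNge (ltW x0).
  apply: (@near_eq_is_derive R R R (cst 0)).
  near=> z.
  rewrite /flat /cst ltNge ltW//; near: z; exact: lt_nbhsl.
have xn : x != 0 by rewrite gt_eqF.
apply: (@near_eq_is_derive R R R (fun z => P.[z^-1] * expR (- z^-1))).
  near=> z; rewrite /flat; case: ifPn => // /negP[]; near: z; exact: lt_nbhsr.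
have hV : is_derive x 1 (fun z : R => z^-1) (- x ^- 2).
  apply: (@is_derive_eq _ _ _ _ _ _ _ _ (@is_deriveV _ id x 1 1 xn (is_derive_id _ _))).
  by rewrite /GRing.scale /= mulr1.
have h1 := @is_derive1_comp _ _ _ x _ _ (is_derive_poly P x^-1) hV.
have h2 := @is_derive1_comp _ _ _ x _ _ (is_derive_expR (- x^-1)) (is_deriveN hV).
have h3 := is_deriveM h1 h2.
apply: (@is_derive_eq _ _ _ _ _ _ _ _ h3).
rewrite /flat x0 hornerM hornerXn hornerD hornerN /comp /=.
change (P.[x^-1] * (expR (- x^-1) * - - x ^- 2) +
  expR (- x^-1) * (P^`().[x^-1] * - x ^- 2) =
  x^-1 ^+ 2 * (P.[x^-1] - P^`().[x^-1]) * expR (- x^-1)).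
by field.
Unshelve. all: by end_near.
Qed.
End flat.

Section smooth_class.
Context {R : realType}.

(** Every constructor has a derivative that is again in the class, so that
    membership implies smoothness of all orders. *)
Inductive smooth_expr : (R -> R) -> Prop :=
| smooth_expr_cst c : smooth_expr (cst c)
| smooth_expr_id : smooth_expr id
| smooth_expr_sin : smooth_expr sin
| smooth_expr_cos : smooth_expr cos
| smooth_expr_flat P : smooth_expr (flat P)
| smooth_expr_smooth f : smooth f -> smooth_expr f
| smooth_expr_add f g : smooth_expr f -> smooth_expr g ->
    smooth_expr (fun x => f x + g x)
| smooth_expr_mul f g : smooth_expr f -> smooth_expr g ->
    smooth_expr (fun x => f x * g x)
| smooth_expr_comp f g : smooth_expr f -> smooth_expr g -> smooth_expr (f \o g)
| smooth_expr_primitive f F : smooth_expr f ->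
    (forall x, is_derive x (1 : R) F (f x)) -> smooth_expr F.

Lemma smooth_expr_derive f : smooth_expr f ->
  exists2 f', smooth_expr f' & forall x, is_derive x (1 : R) f (f' x).
Proof.
elim=> {f} [c||||P|f fs|f g _ [f' sf' df] _ [g' sg' dg]
  |f g sf [f' sf' df] sg [g' sg' dg]|f g _ [f' sf' df] sg [g' sg' dg]|f F sf _ dF].
- by exists (cst 0) => [|x]; [exact: smooth_expr_cst|exact: is_derive_cst].
- by exists (cst 1) => [|x]; [exact: smooth_expr_cst|exact: is_derive_id].
- by exists cos => [|x]; [exact: smooth_expr_cos|exact: is_derive_sin].
- exists (fun x => -1 * sin x) => [|x]; last by rewrite mulN1r; exact: is_derive_cos.
  by apply: smooth_expr_mul; [exact: (smooth_expr_cst (-1))|exact: smooth_expr_sin].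
- by exists (flat ('X^2 * (P - P^`()))) => [|x];
    [exact: smooth_expr_flat|exact: is_derive_flat].
- exists ('D_1 f) => [|x].
    by apply: smooth_expr_smooth => k; have [_ /(_ 1) []] := fs k.+1.
  by apply: derivableP; have [_ /(_ 1) [+ _]] := fs 1%N; apply.
- by exists (fun x => f' x + g' x) => [|x];
    [exact: smooth_expr_add|exact: (is_deriveD (df x) (dg x))].
- exists (fun x => f x * g' x + g x * f' x) => [|x]; last exact: (is_deriveM (df x) (dg x)).
  by apply: smooth_expr_add; exact: smooth_expr_mul.
- exists (fun x => f' (g x) * g' x) => [|x].
    by apply: smooth_expr_mul => //; exact: (smooth_expr_comp sf' sg).
  exact: (is_derive1_comp (df (g x)) (dg x)).
- by exists f.
Qed.

Lemma smooth_expr_continuous f : smooth_expr f -> continuous f.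
Proof.
move=> /smooth_expr_derive[f' _ df] x.
by apply: differentiable_continuous; apply/derivable1_diffP; have [] := df x.
Qed.

Lemma is_derive_dir {V : normedModType R} (f : R -> V) x df v :
  is_derive x (1 : R) f df -> is_derive x v f (v *: df).
Proof.
move=> [fx <-]; have fd : differentiable f x by apply/derivable1_diffP.
apply: DeriveDef; first exact: diff_derivable.
rewrite !deriveE// -{1}[v]mulr1; exact: linearZ.
Qed.

(** Induction on the order, for all members of the class at once: the derivative of
    f *: w in direction v is (v * f') *: w, which is of the same form. *)
Lemma smooth_exprW {V : normedModType R} (w : V) f :
  smooth_expr f -> smooth (fun t => f t *: w).
Proof.
move=> sf k; elim: k f sf => [|k IH] f sf.
  split=> // x _; apply: cvgZr_tmp; exact: smooth_expr_continuous.
split=> [x _|v].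
  apply: cvgZr_tmp; exact: smooth_expr_continuous.
have [f' sf' df] := smooth_expr_derive sf.
have dw x : is_derive x v (fun t => f t *: w) ((v * f' x) *: w).
  rewrite -scalerA; apply: is_derive_dir.
  have fd : differentiable f x by apply/derivable1_diffP; have [] := df x.
  have fwd : differentiable (fun t => f t *: w) x by exact: differentiableZl.
  apply: DeriveDef; first exact: diff_derivable.
  rewrite deriveE// diffZl//= -deriveE//; by have [_ ->] := df x.
split=> [x _|]; first by have [] := dw x.
have -> : 'D_v (fun t => f t *: w) = (fun x => (v * f' x) *: w).
  by apply/funext => x; have [_ ->] := dw x.
by apply: IH; apply: (smooth_expr_mul (smooth_expr_cst v)).
Qed.

Lemma smooth_expr_is_smooth (f : R -> R) : smooth_expr f -> smooth f.
Proof.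
move=> /(smooth_exprW (1 : R^o)); congr smooth.
by apply/funext => x; rewrite /GRing.scale /= mulr1.
Qed.

End smooth_class.

(** * Integrals over an interval *)

Section ae_eq_integral_nonmeasurable.
Local Open Scope ereal_scope.
Context d (T : measurableType d) (R : realType).
Variable mu : {measure set T -> \bar R}.
Import HBNNSimple.

Lemma ge0_le_integral_ae_nonmeasurable (f g : T -> \bar R) :
  (forall x, 0 <= f x) -> (forall x, 0 <= g x) ->
  {ae mu, forall x, f x <= g x} -> \int[mu]_x f x <= \int[mu]_x g x.
Proof.
move=> f0 g0 [N [mN N0 subN]].
rewrite ge0_integralTE// ge0_integralTE//.
apply: ge_ereal_sup => /= _ [h hf <-].
apply: ereal_sup_ubound => /=.
have mCN : measurable (~` N) by exact: measurableC.
exists (proj_nnsfun h mCN) => [x|].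
  rewrite -(mrestrict h mCN) patchE in_setC; case: (boolP (x \in N)) => // xN /=.
  apply: (le_trans (hf x)); apply: contrapT => /subN Nx.
  by rewrite mem_set in xN.
rewrite -!integralT_nnsfun; apply: ae_eq_integral => //.
- exact/measurable_EFinP.
- exact/measurable_EFinP.
exists N; split=> // x /not_implyP[_ hx]; apply: contrapT => xN; apply: hx.
by rewrite -(mrestrict h mCN) patchE in_setC memNset.
Qed.

(** An integral of a nonnegative function is a supremum over the simple functions
    below it, and multiplying these by the indicator of the complement of a null
    set does not change their integral; so the identity
    holds for arbitrary functions. This matters because the bending energy density q2 is known on skew matrices only:
    on the null set where the strain fails to be skew, the integrand is
    arbitrary. *)
Lemma ae_eq_integral_nonmeasurable (D : set T) (f g : T -> \bar R) :
  {ae mu, forall x, D x -> f x = g x} ->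
  \int[mu]_(x in D) f x = \int[mu]_(x in D) g x.
Proof.
move=> fg; rewrite integral_mkcond [RHS]integral_mkcond.
have {fg} : {ae mu, forall x, (f \_ D) x = (g \_ D) x}.
  apply: filterS fg => x fg; rewrite !patchE; case: ifPn => // /set_mem Dx.
  exact: fg.
move: (f \_ D) (g \_ D) => {D}{}f {}g fg.
rewrite integralE [RHS]integralE.
have key (F : (T -> \bar R) -> T -> \bar R) : (forall h x, 0 <= F h x) ->
    (forall h k x, h x = k x -> F h x = F k x) ->
    \int[mu]_x F f x = \int[mu]_x F g x.
  move=> F0 FE; apply/eqP; rewrite eq_le; apply/andP; split;
    apply: ge0_le_integral_ae_nonmeasurable => //;
    by apply: filterS fg => x fgx; rewrite (FE _ _ _ fgx).
congr (_ - _); first by apply: (key (fun h => h^\+)) => // h k x; rewrite !funeposE => ->.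
by apply: (key (fun h => h^\-)) => // h k x; rewrite !funenegE => ->.
Qed.

End ae_eq_integral_nonmeasurable.

Section scalar_classes.
Context {R : realType}.
Variable L : R.
Implicit Types f g : R -> R.
Local Notation mu := (@lebesgue_measure R).
Local Notation D := (`]0, L[%classic : set R).

(** The scalar version of L2; a matrix field is in L2 when each of its
    entries satisfies this. *)
Definition L2fun (f : R -> R) : Prop :=
  measurable_fun (D : set (measurableTypeR R)) f /\
  (\int[mu]_(t in D) ((f t) ^+ 2)%:E < +oo)%E.

Definition ess_bdd (f : R -> R) : Prop :=
  measurable_fun (D : set (measurableTypeR R)) f /\
  exists C, ae_on L (fun t => `|f t| <= C).

Definition L1fun (f : R -> R) : Prop := mu.-integrable D (EFin \o f).

Lemma measurable_interval : measurable (D : set (measurableTypeR R)).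
Proof. exact: measurable_itv. Qed.
Hint Resolve measurable_interval : core.

Lemma mu_interval_lty : (mu D < +oo)%E.
Proof. by rewrite lebesgue_measure_itv/=; case: ifP => // _; rewrite -EFinB ltry. Qed.

Lemma ae_onT (P : R -> Prop) : (forall t, `]0, L[%classic t -> P t) -> ae_on L P.
Proof. by move=> h; exact: aeW. Qed.

Lemma ae_on_imp (P P' : R -> Prop) : (forall t, `]0, L[%classic t -> P t -> P' t) ->
  ae_on L P -> ae_on L P'.
Proof.
move=> h; rewrite /ae_on; apply: filterS; first exact: (ae_filter_ringOfSetsType mu).
by move=> t Pt Dt; apply: h => //; exact: Pt.
Qed.

Lemma ae_on_and (P P' : R -> Prop) : ae_on L P -> ae_on L P' -> ae_on L (fun t => P t /\ P' t).
Proof.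
rewrite /ae_on; apply: filterS2; first exact: (ae_filter_ringOfSetsType mu).
by move=> t a b Dt; split; [exact: a|exact: b].
Qed.

Lemma int1_ae f g : ae_on L (fun t => f t = g t) -> int1 `]0, L[ f = int1 `]0, L[ g.
Proof.
move=> fg; rewrite /int1 /Rintegral; congr fine.
apply: ae_eq_integral_nonmeasurable; apply: ae_on_imp fg => t _ ->.
by [].
Qed.

Lemma measurable_sq f : measurable_fun (D : set (measurableTypeR R)) f ->
  measurable_fun (D : set (measurableTypeR R)) (fun t => ((f t) ^+ 2)%:E).
Proof. by move=> mf; apply/measurable_EFinP; exact: measurable_funX. Qed.

Lemma L2fun_le C f g : measurable_fun (D : set (measurableTypeR R)) f -> L2fun g ->
  ae_on L (fun t => `|f t| <= C * `|g t|) -> L2fun f.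
Proof.
move=> mf [mg ig] fg; split => //.
apply: (@le_lt_trans _ _ (\int[mu]_(t in D) ((C ^+ 2)%:E * (g t ^+ 2)%:E))%E).
  apply: ae_ge0_le_integral => //.
  - by move=> t _; rewrite lee_fin sqr_ge0.
  - exact: measurable_sq.
  - by move=> t _; rewrite -EFinM lee_fin mulr_ge0 ?sqr_ge0.
  - apply: emeasurable_funM => //; exact: measurable_sq.
  - apply: ae_on_imp fg => t _ h.
    rewrite -EFinM lee_fin -(real_normK (num_real (f t))) -(real_normK (num_real (g t))).
    by rewrite -exprMn ler_pXn2r ?nnegrE// (le_trans _ h).
rewrite ge0_integralZl_EFin ?sqr_ge0//.
- by rewrite lte_mul_pinfty ?lee_fin ?sqr_ge0.
- by move=> t _; rewrite lee_fin sqr_ge0.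
- exact: measurable_sq.
Qed.

Lemma L2fun_add f g : L2fun f -> L2fun g -> L2fun (fun t => f t + g t).
Proof.
move=> [mf fi] [mg gi]; split; first exact: measurable_funD.
apply: (@le_lt_trans _ _
  (\int[mu]_(t in D) (2%:E * (f t ^+ 2)%:E + 2%:E * (g t ^+ 2)%:E))%E).
  apply: ge0_le_integral => //.
  - by move=> t _; rewrite lee_fin sqr_ge0.
  - by apply: measurable_sq; exact: measurable_funD.
  - by apply: emeasurable_funD; apply: emeasurable_funM => //; exact: measurable_sq.
  - move=> t _; rewrite -!EFinM -EFinD lee_fin.
    by have := sqr_ge0 (f t - g t); nra.
rewrite ge0_integralD//.
- rewrite !ge0_integralZl_EFin//; try by move=> t _; rewrite lee_fin sqr_ge0.
  + by rewrite lte_add_pinfty// lte_mul_pinfty.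
  + exact: measurable_sq.
  + exact: measurable_sq.
- by move=> t _; rewrite -EFinM lee_fin mulr_ge0 ?sqr_ge0.
- by apply: emeasurable_funM => //; exact: measurable_sq.
- by move=> t _; rewrite -EFinM lee_fin mulr_ge0 ?sqr_ge0.
- by apply: emeasurable_funM => //; exact: measurable_sq.
Qed.

Lemma ess_bdd_cst c : ess_bdd (cst c).
Proof. by split; [exact: measurable_cst|exists `|c|; exact: ae_onT]. Qed.

Lemma ess_bdd_add f g : ess_bdd f -> ess_bdd g -> ess_bdd (fun t => f t + g t).
Proof.
move=> [mf [C hC]] [mg [C' hC']]; split; first exact: measurable_funD.
exists (C + C'); have := ae_on_and hC hC'; apply: ae_on_imp => t _ [h h'].
by apply: le_trans (ler_normD _ _) _; exact: lerD.
Qed.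

Lemma ess_bdd_mul f g : ess_bdd f -> ess_bdd g -> ess_bdd (fun t => f t * g t).
Proof.
move=> [mf [C hC]] [mg [C' hC']]; split; first exact: measurable_funM.
exists (C * C'); have := ae_on_and hC hC'; apply: ae_on_imp => t _ [h h'].
by rewrite normrM ler_pM.
Qed.

Lemma ess_bdd_opp f : ess_bdd f -> ess_bdd (fun t => - f t).
Proof.
move=> [mf [C hC]]; split; first exact: measurableT_comp.
by exists C; apply: ae_on_imp hC => t _; rewrite normrN.
Qed.

Lemma L2fun_opp f : L2fun f -> L2fun (fun t => - f t).
Proof.
move=> fi; apply: (@L2fun_le 1 _ f) => //; first by case: fi => mf _; exact: measurableT_comp.
by apply: ae_onT => t _; rewrite normrN mul1r.
Qed.

Lemma L2fun_mul f g : ess_bdd f -> L2fun g -> L2fun (fun t => f t * g t).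
Proof.
move=> [mf [C hC]] gi; apply: (@L2fun_le C _ g) => //.
  by apply: measurable_funM => //; case: gi.
by apply: ae_on_imp hC => t _ h; rewrite normrM ler_wpM2r.
Qed.

Lemma L2fun_cst c : L2fun (cst c).
Proof.
split; first exact: measurable_cst.
rewrite (_ : (fun _ => _) = cst ((c ^+ 2)%:E)) //.
by rewrite integral_cst// lte_mul_pinfty ?lee_fin ?sqr_ge0// mu_interval_lty.
Qed.

Lemma ess_bdd_L2fun f : ess_bdd f -> L2fun f.
Proof.
move=> fb; have := L2fun_mul fb (L2fun_cst 1).
by congr L2fun; apply/funext => t /=; rewrite mulr1.
Qed.

Lemma L1fun_mul f g : L2fun f -> L2fun g -> L1fun (fun t => f t * g t).
Proof.
move=> [mf fi] [mg gi].
have sqint (h : R -> R) : measurable_fun (D : set (measurableTypeR R)) h ->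
    (\int[mu]_(t in D) ((h t) ^+ 2)%:E < +oo)%E ->
    mu.-integrable D (EFin \o (fun t => h t ^+ 2)).
  move=> mh hi; apply/integrableP; split; first exact: measurable_sq.
  by under eq_integral do rewrite /= ger0_norm ?sqr_ge0//.
apply: (le_integrable _ _ _ (integrableD _ (sqint _ mf fi) (sqint _ mg gi))) => //.
  by apply/measurable_EFinP; exact: measurable_funM.
move=> t _; rewrite /= lee_fin normrM [leRHS]ger0_norm ?addr_ge0 ?sqr_ge0//.
rewrite -[f t ^+ 2]real_normK ?num_real// -[g t ^+ 2]real_normK ?num_real//.
have := sqr_ge0 (`|f t| - `|g t|); have := normr_ge0 (f t); have := normr_ge0 (g t).
by nra.
Qed.

Lemma L2fun_L1fun f : L2fun f -> L1fun f.
Proof.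
move=> fi; have := L1fun_mul (L2fun_cst 1) fi.
by congr L1fun; apply/funext => t /=; rewrite mul1r.
Qed.

Lemma ess_bdd_sum (I : Type) (r : seq I) (F : I -> R -> R) :
  (forall i, ess_bdd (F i)) -> ess_bdd (fun t => \sum_(i <- r) F i t).
Proof.
move=> hF; elim: r => [|i r IH].
  by under eq_fun do rewrite big_nil; exact: ess_bdd_cst.
by under eq_fun do rewrite big_cons; exact: ess_bdd_add.
Qed.

Lemma L2fun_sum (I : Type) (r : seq I) (F : I -> R -> R) :
  (forall i, L2fun (F i)) -> L2fun (fun t => \sum_(i <- r) F i t).
Proof.
move=> hF; elim: r => [|i r IH].
  by under eq_fun do rewrite big_nil; exact: L2fun_cst.
by under eq_fun do rewrite big_cons; exact: L2fun_add.
Qed.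

Lemma continuous_ess_bdd f : {within `[0, L], continuous f} -> ess_bdd f.
Proof.
move=> fc; have mf : measurable_fun (D : set (measurableTypeR R)) f.
  apply: (@measurable_funS _ _ (measurableTypeR R) _ (`[0, L]%classic)) => //.
    exact: subset_itv_oo_cc.
  exact: subspace_continuous_measurable_fun.
split=> //.
have [L0|L0] := ltP 0 L; last first.
  exists 0; apply: ae_onT => t /=; rewrite in_itv /= => /andP[t0 tL]; lra.
have [M [_ hM]] := compact_bounded (continuous_compact fc (@segment_compact _ 0 L)).
exists (M + 1); apply: ae_onT => t Dt; apply: (hM (M + 1)); first lra.
by exists t => //; exact: (subset_itv_oo_cc Dt).
Qed.

End scalar_classes.

(** * The fundamental lemma of the calculus of variations *)

Section bump.
Context {R : realType}.

(** As k grows these converge to the indicator of the open interval (a, b). *)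
Definition bump (a b : R) (k : nat) (x : R) : R :=
  flat 1 (k%:R * (x - a)) * flat 1 (k%:R * (b - x)).

Lemma flat1_itv (x : R) : 0 <= flat 1 x <= 1.
Proof.
rewrite /flat; case: ifPn => x0; last by rewrite lexx ler01.
by rewrite hornerC mul1r expR_ge0 expR_le1 oppr_le0 invr_ge0 ltW.
Qed.

Lemma bump_norm_le1 a b k x : `|bump a b k x| <= 1.
Proof.
have /andP[u0 u1] := flat1_itv (k%:R * (x - a)).
have /andP[v0 v1] := flat1_itv (k%:R * (b - x)).
by rewrite /bump ger0_norm ?mulr_ge0// mulr_ile1.
Qed.

Lemma bump_eq0 a b k x : ~~ (a < x < b) -> bump a b k x = 0.
Proof.
rewrite negb_and -!leNgt /bump /flat => /orP[xa|bx].
  by rewrite ltNge mulr_ge0_le0 ?subr_le0// mul0r.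
by rewrite [X in _ * X]ifF ?mulr0// ltNge mulr_ge0_le0 ?subr_le0.
Qed.

Lemma smooth_expr_bump a b k : smooth_expr (bump a b k).
Proof.
have aff (c d : R) : smooth_expr (fun x => c * x + d).
  apply: smooth_expr_add; last exact: (smooth_expr_cst d).
  by apply: smooth_expr_mul; [exact: (smooth_expr_cst c)|exact: smooth_expr_id].
rewrite (_ : bump a b k = fun x => (flat 1 \o (fun x => k%:R * x + - (k%:R * a))) x *
    (flat 1 \o (fun x => - k%:R * x + k%:R * b)) x); last first.
  apply/funext => x; rewrite /bump /=; congr (flat _ _ * flat _ _); ring.
by apply: smooth_expr_mul; apply: smooth_expr_comp => //; exact: smooth_expr_flat.
Qed.

Lemma flat1_cvg (x : R) : 0 < x -> flat 1 (k%:R * x) @[k --> \oo] --> (1 : R).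
Proof.
move=> x0.
have h : expR (- (k%:R * x)^-1) @[k --> \oo] --> (1 : R).
  rewrite -[X in _ --> X]expR0; apply: continuous_cvg; first exact: continuous_expR.
  rewrite -[X in _ --> X]oppr0; apply: cvgN.
  rewrite -[X in _ --> X](mul0r x^-1).
  under eq_fun do rewrite invfM.
  apply: cvgMr_tmp; apply/gtr0_cvgV0; last exact: cvgr_idn.
  by near=> n; rewrite ltr0n; near: n; exact: nbhs_infty_gt.
apply: cvg_trans h; apply: near_eq_cvg; near=> k.
rewrite /flat ifT ?hornerC ?mul1r// mulr_gt0// ltr0n.
by near: k; exact: nbhs_infty_gt.
Unshelve. all: by end_near. Qed.

Lemma bump_cvg a b x : bump a b k x @[k --> \oo] --> (\1_(`]a, b[) x : R).
Proof.
rewrite indicE; case: (boolP (a < x < b)) => xab.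
  rewrite mem_set /=; last by rewrite in_itv.
  rewrite -[1%:R]mulr1; move/andP: xab => [ax xb].
  by apply: cvgM; apply: flat1_cvg; rewrite subr_gt0.
rewrite memNset /=; last by rewrite in_itv/=; exact/negP.
by under eq_fun do rewrite bump_eq0//; exact: cvg_cst.
Qed.

Lemma test_function_bump (L a b : R) k : 0 < a -> b < L -> test_function `]0, L[ (bump a b k).
Proof.
move=> a0 bL.
have sub : closure [set x | bump a b k x != 0] `<=` `[a, b].
  have := @interval_closed R (BLeft a) (BRight b) erefl erefl.
  move=> /closure_id ->; apply: closureS => x /=.
  apply: contraNT; rewrite in_itv/= => h; apply/eqP/bump_eq0.
  by apply: contra h => /andP[/ltW -> /ltW ->].
split.
- exact/smooth_expr_is_smooth/smooth_expr_bump.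
- apply: (subclosed_compact _ (@segment_compact _ a b)) => //; exact: closed_closure.
- move=> x /sub; rewrite /= !in_itv/= => /andP[h1 h2].
  by rewrite (lt_le_trans a0)//= (le_lt_trans h2).
Qed.

End bump.

Section fundamental.
Context {R : realType}.
Variable L : R.
Implicit Types f g : R -> R.
Local Notation mu := (@lebesgue_measure R).
Local Notation D := (`]0, L[%classic : set R).

(** Dominated convergence along the bump functions of (a, b). *)
Lemma integral_test0_itv g (a b : R) : L1fun L g ->
  (forall phi, test_function `]0, L[ phi -> int1 `]0, L[ (fun t => g t * phi t) = 0) ->
  0 < a -> b < L -> \int[mu]_(t in `]a, b[) g t = 0.
Proof.
move=> gi g0 a0 bL.
have mg : measurable_fun (D : set (measurableTypeR R)) g.
  by apply/measurable_EFinP; exact: measurable_int gi.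
have mD := @measurable_interval R L.
have mb k : measurable_fun (D : set (measurableTypeR R)) (bump a b k).
  by apply: measurable_funTS; apply: continuous_measurable_fun;
    apply: smooth_expr_continuous; exact: smooth_expr_bump.
have bi k : mu.-integrable D (EFin \o (fun t => g t * bump a b k t)).
  apply: le_integrable gi => //.
    by apply/measurable_EFinP; exact: measurable_funM.
  by move=> t _; rewrite /= lee_fin normrM ler_piMr ?bump_norm_le1.
have ml : measurable_fun (D : set (measurableTypeR R)) (fun t => (g t * \1_(`]a, b[) t)%:E).
  by apply/measurable_EFinP; apply: measurable_funM => //; exact: measurable_indic.
have cv : {ae mu, forall t, D t ->
    (g t * bump a b k t)%:E @[k --> \oo] --> (g t * \1_(`]a, b[) t)%:E}.
  apply: aeW => t _; apply: cvg_EFin; first by apply: nearW.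
  by apply: cvgMl_tmp; exact: bump_cvg.
have dom : {ae mu, forall t k, D t -> (`|(g t * bump a b k t)%:E| <= `|g t|%:E)%E}.
  by apply: aeW => t k _; rewrite /= lee_fin normrM ler_piMr ?bump_norm_le1.
have [_ _ h] := dominated_convergence mD (fun k => measurable_int _ (bi k)) ml cv
  (integrable_norm gi) dom.
have z k : (\int[mu]_(t in D) (g t * bump a b k t)%:E = 0)%E.
  have := g0 _ (test_function_bump k a0 bL).
  rewrite /int1 /Rintegral => h0; rewrite -[LHS]fineK ?h0//.
  exact: integrable_fin_num (bi k).
rewrite (_ : [sequence _]_n = cst 0%E) in h; last by apply/funext => k; exact: z.
have := cvg_unique _ h (cvg_cst _) => /(_ (@ereal_hausdorff R)).
move=> h1; rewrite /Rintegral.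
rewrite (_ : (\int[mu]_(t in `]a, b[) (g t)%:E)%E = 0%E) //.
rewrite -h1 -[X in (\int[_]_(_ in X) _)%E = _](@setIidr _ D); last first.
  by apply: subset_itv; rewrite bnd_simp ltW.
rewrite integral_mkcondr; apply: eq_integral => t _.
by rewrite epatch_indic EFinM.
Qed.

(** The primitive of g, extended by zero, is constant on the interval; by Lebesgue's
    differentiation theorem its derivative is g almost everywhere. *)
Lemma fundamental_lemma g : L1fun L g ->
  (forall phi, test_function `]0, L[ phi -> int1 `]0, L[ (fun t => g t * phi t) = 0) ->
  ae_on L (fun t => g t = 0).
Proof.
move=> gi g0.
have mD := @measurable_interval R L.
pose h := g \_ D.
have hi : mu.-integrable setT (EFin \o h).
  by rewrite /h -restrict_EFin; apply/integrable_restrict => //; rewrite setTI.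
have hil (y : R) : mu.-integrable `]-oo, y] (EFin \o h) by apply: integrableS hi.
have := FTC1Ny hil (open_integrable_locally openT hi).
rewrite /ae_on; apply: filterS; first exact: (ae_filter_ringOfSetsType mu).
move=> x [_ Fx] Dx; move: (Dx); rewrite /= in_itv /= => /andP[x0 xL].
have -> : g x = h x by rewrite /h patchE mem_set.
rewrite -Fx.
pose F (y : R) := \int[mu]_(t in `]-oo, y]) h t.
rewrite -[LHS]/(derive1 F x).
have Fcst y z : 0 < y -> y < z -> z < L -> F z = F y.
  move=> y0 yz zL; apply/eqP; rewrite -subr_eq0; apply/eqP.
  rewrite /F Rintegral_itvB ?bnd_simp//; last exact: ltW.
  rewrite -Rintegral_itv_bndo_bndc; last by apply: integrableS hi.
  rewrite -(integral_test0_itv gi g0 y0 zL); apply: eq_Rintegral => t.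
  rewrite inE /h patchE => tyz; rewrite mem_set //.
  by apply: subset_itv tyz; rewrite bnd_simp ltW.
pose c := F x.
have : \near x, F x = cst c x.
  near=> y; rewrite /cst /c.
  have y0 : 0 < y by near: y; exact: lt_nbhsr.
  have yL : y < L by near: y; exact: lt_nbhsl.
  by have [yx|yx|->//] := ltgtP y x; [rewrite (Fcst y x)|rewrite (Fcst x y)].
move=> /(near_eq_derive (1 : R)).
by rewrite derive1E => ->; rewrite derive_cst.
Unshelve. all: by end_near. Qed.

End fundamental.

(** * Tail integrals and traces *)

Section tail.
Context {R : realType}.
Variable L : R.
Implicit Types f g : R -> R.
Local Notation mu := (@lebesgue_measure R).
Local Notation D := (`]0, L[%classic : set R).

Lemma L1fun_patch f : L1fun L f -> mu.-integrable setT (EFin \o (f \_ D)).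
Proof.
move=> fi; have mD := @measurable_interval R L.
by rewrite -restrict_EFin; apply/integrable_restrict => //; rewrite setTI.
Qed.

Lemma tail_continuous f : 0 < L -> L1fun L f ->
  {within `[0, L], continuous (fun x => int1 `]x, L[ f)}.
Proof.
move=> L0 /L1fun_patch hi; set h := f \_ D in hi.
have hA (A : set (measurableTypeR R)) : measurable A -> mu.-integrable A (EFin \o h).
  by move=> mA; apply: integrableS hi.
pose c := \int[mu]_(t in `[0, L]) h t.
have KE x : 0 <= x -> x <= L ->
    c - parameterized_integral mu 0 x h = int1 `]x, L[ f.
  move=> x0 xL.
  rewrite /c /parameterized_integral Rintegral_itvB ?bnd_simp//; last exact: hA.
  rewrite -Rintegral_itv_bndo_bndc; last exact: hA.
  apply: eq_Rintegral => t; rewrite inE => txL.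
  rewrite /h patchE mem_set//; apply: subset_itv txL; rewrite bnd_simp//.
have ct : {within `[0, L], continuous (fun x => c - parameterized_integral mu 0 x h)}.
  have pc := parameterized_integral_continuous (ltW L0) (hA _ (measurable_itv _)).
  by move=> x; apply: cvgB; [exact: cvg_cst|exact: pc].
apply: (subspace_eq_continuous _ ct) => x.
by rewrite inE /= in_itv /= => /andP[x0 xL]; exact: KE.
Qed.

Lemma int1_derivative (phi phi' : R -> R) (z : R) : 0 < z ->
  continuous phi' -> (forall x, is_derive x (1 : R) phi (phi' x)) ->
  int1 `]0, z[ phi' = phi z - phi 0.
Proof.
move=> z0 phi'c dphi.
have phic : continuous phi.
  by move=> x; apply: differentiable_continuous; apply/derivable1_diffP; have [] := dphi x.
have dz : derivable_oo_LRcontinuous phi 0 z.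
  split; first by move=> x _; have [] := dphi x.
    exact/cvg_at_right_filter/phic.
  exact/cvg_at_left_filter/phic.
have := continuous_FTC2 z0 (continuous_subspaceT phi'c) dz _.
rewrite integral_itv_bndoo; last first.
  apply/measurable_EFinP; apply: measurable_funTS.
  exact: continuous_measurable_fun.
rewrite /int1 /Rintegral => -> // x _.
by rewrite derive1E; have [_ ->] := dphi x.
Qed.

(** Integration by parts for the absolutely continuous function
    t |-> int_t^L f. Writing phi z - phi 0 as the integral of phi' over (0, z), the
    last term is the integral of phi' t * f z over the triangle t < z. *)
Lemma fubini_tail f (phi phi' : R -> R) : 0 < L -> L1fun L f ->
  continuous phi' -> (forall x, is_derive x (1 : R) phi (phi' x)) ->
  int1 `]0, L[ (fun t => phi t * f t) =
  phi 0 * int1 `]0, L[ f + int1 `]0, L[ (fun t => phi' t * int1 `]t, L[ f).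
Proof.
move=> L0 fi phi'c dphi; have hi := L1fun_patch fi.
have mD := @measurable_interval R L.
set h := f \_ D in hi.
have hA (A : set (measurableTypeR R)) : measurable A -> mu.-integrable A (EFin \o h).
  by move=> mA; apply: integrableS hi.
pose P := phi' \_ D.
have Pi : mu.-integrable setT (EFin \o P).
  apply: L1fun_patch; apply: L2fun_L1fun; apply: ess_bdd_L2fun.
  by apply: continuous_ess_bdd; exact: continuous_subspaceT.
have phic : continuous phi.
  by move=> x; apply: differentiable_continuous; apply/derivable1_diffP; have [] := dphi x.
have mh : measurable_fun setT h by apply/measurable_EFinP; exact: measurable_int hi.
have mP : measurable_fun setT P by apply/measurable_EFinP; exact: measurable_int Pi.
(* The integrand on the triangle x.1 < x.2, with both factors extended by zero. *)
pose G (x : R * R) : R := P x.1 * (h x.2 * \1_[set y : R * R | y.1 < y.2] x).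
have mlt : measurable ([set y : R * R | y.1 < y.2] : set (measurableTypeR R * measurableTypeR R)).
  rewrite -[X in measurable X]setTI; 
  rewrite (_ : [set _ | _] = (fun y : R * R => y.1 < y.2) @^-1` [set true]); last first.
    by apply/seteqP; split.
  by apply: measurable_fun_ltr.
have mG : measurable_fun (setT : set (measurableTypeR R * measurableTypeR R)) (EFin \o G).
  apply/measurable_EFinP; apply: measurable_funM.
    exact: measurableT_comp mP measurable_fst.
  apply: measurable_funM.
    exact: measurableT_comp mh measurable_snd.
  exact: measurable_indic.
have Gi : ((mu \x mu)%E).-integrable setT (EFin \o G).
  apply/(integrable12ltyP mu mu mG).
  pose c := (\int[mu]_z `|h z|%:E)%E.
  have clty : (c < +oo)%E by case/integrableP : hi.
  apply: (@le_lt_trans _ _ (\int[mu]_t (`|P t|%:E * c))%E).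
    apply: ge0_le_integral => //.
    - by move=> t _; exact: integral_ge0.
    - have mabs := measurableT_comp (@abse_measurable R setT) mG.
      exact: (@measurable_fun_fubini_tonelli_F _ _ _ _ _ mu _ mabs (fun x => abse_ge0 _)).
    - apply: emeasurable_funM => //.
      by apply/measurable_EFinP; exact: measurableT_comp.
    - move=> t _; rewrite /c -ge0_integralZl_EFin//.
        apply: ge0_le_integral => //.
        + apply: measurableT_comp => //.
          exact: (measurableT_comp mG (@pair1_measurable _ _ _ _ t)).
        + by apply: emeasurable_funM => //; apply/measurable_EFinP; exact: measurableT_comp.
        + move=> z _; rewrite /= lee_fin /G !normrM ler_wpM2l// ler_piMr//.
          by rewrite indicE; case: (_ \in _); rewrite ?normr1 ?normr0.
      by apply/measurable_EFinP; exact: measurableT_comp.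
  rewrite ge0_integralZr//; last 2 first.
  - by apply/measurable_EFinP; exact: measurableT_comp.
  - by apply: integral_ge0.
  by rewrite lte_mul_pinfty ?integral_ge0//; case/integrableP : Pi => // _ ?;
    rewrite fin_numElt; apply/andP; split; rewrite // (lt_le_trans (ltNyr 0))// integral_ge0.
have GE t z : (EFin \o G) (t, z) = ((P t)%:E * ((EFin \o h) \_ `]t, +oo[) z)%E.
  rewrite /= /G /= indicE patchE; have [tz|tz] := ltP t z.
    by rewrite !mem_set//= ?in_itv/= ?tz// mulr1 EFinM.
  rewrite !memNset//=; first by rewrite !mulr0 mule0.
    by rewrite in_itv/= andbT; apply/negP; rewrite -leNgt.
  by apply/negP; rewrite -leNgt.
have GE' t z : (EFin \o G) (t, z) = ((h z)%:E * ((EFin \o P) \_ `]-oo, z[) t)%E.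
  rewrite /= /G /= indicE patchE; have [tz|tz] := ltP t z.
    by rewrite !mem_set//= ?in_itv/= ?tz// mulr1 EFinM muleC.
  rewrite !memNset//=; first by rewrite !mulr0 mule0.
    by rewrite in_itv/=; apply/negP; rewrite -leNgt.
  by apply/negP; rewrite -leNgt.
have PA (A : set (measurableTypeR R)) : measurable A -> mu.-integrable A (EFin \o P).
  by move=> mA; apply: integrableS Pi.
have Gz t : (\int[mu]_z (EFin \o G) (t, z))%E = ((P t) * \int[mu]_(z in `]t, +oo[) h z)%:E.
  under eq_integral do rewrite GE.
  rewrite integralZl//; last first.
    by apply/integrable_restrict => //; rewrite setTI; exact: hA.
  rewrite -integral_mkcond EFinM /Rintegral fineK//.
  exact: integrable_fin_num (hA _ _).
have Gt z : (\int[mu]_t (EFin \o G) (t, z))%E = (h z * \int[mu]_(t in `]-oo, z[) P t)%:E.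
  under eq_integral do rewrite GE'.
  rewrite integralZl//; last first.
    by apply/integrable_restrict => //; rewrite setTI; exact: PA.
  rewrite -integral_mkcond EFinM /Rintegral fineK//.
  exact: integrable_fin_num (PA _ _).
have := Fubini Gi.
under eq_integral do rewrite Gz.
under [X in _ = X]eq_integral do rewrite Gt.
move=> /(congr1 fine); rewrite -!/(Rintegral _ _ _) => FT.
(* The two inner integrals are the tail of f and the increment of phi. *)
have E1 : int1 `]0, L[ (fun t => phi' t * int1 `]t, L[ f) =
    \int[mu]_t (P t * \int[mu]_(z in `]t, +oo[) h z).
  rewrite /int1 Rintegral_mkcond; apply: eq_Rintegral => t _.
  rewrite /P !patchE; case: ifPn => tD; last by rewrite mul0r.
  congr (_ * _); rewrite /h -Rintegral_mkcondr; congr (Rintegral _ _ _).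
  move: tD; rewrite inE /= in_itv/= => /andP[t0 tL].
  apply/seteqP; split => z /=; rewrite !in_itv/= ?andbT.
    by move=> /andP[tz ->]; rewrite tz (lt_trans t0).
  by move=> [-> /andP[_ ->]].
have E2 : int1 `]0, L[ (fun t => f t * (phi t - phi 0)) =
    \int[mu]_z (h z * \int[mu]_(t in `]-oo, z[) P t).
  rewrite /int1 Rintegral_mkcond; apply: eq_Rintegral => z _.
  rewrite /h !patchE; case: ifPn => zD; last by rewrite mul0r.
  congr (_ * _); rewrite /P -Rintegral_mkcondr.
  move: zD; rewrite inE /= in_itv/= => /andP[z0 zL].
  have -> : (`]-oo, z[ `&` D)%classic = `]0, z[%classic.
    apply/seteqP; split => t /=; rewrite !in_itv/=.
      by move=> [-> /andP[-> _]].
    by move=> /andP[-> tz]; rewrite tz (lt_trans tz).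
  by rewrite -(int1_derivative z0 phi'c dphi).
rewrite E1 FT -E2 /int1 -RintegralZl// -RintegralD//.
- by apply: eq_Rintegral => t _; ring.
- exact: (integrableZl _ (phi 0) fi).
- have phib : continuous (fun t => phi t - phi 0).
    by move=> t; apply: cvgB; [exact: phic|exact: cvg_cst].
  have bd : [bounded phi t - phi 0 | t in D].
    have [M [Mr hM]] := compact_bounded (continuous_compact
      (continuous_subspaceT phib) (@segment_compact _ 0 L)).
    exists M; split=> // M' MM' t Dt; apply: hM MM' _ _.
    by exists t => //; exact: (subset_itv_oo_cc Dt).
  have mb : measurable_fun (D : set (measurableTypeR R)) (fun t => phi t - phi 0).
    by apply: measurable_funTS; exact: continuous_measurable_fun.
  have := integrableMl mD fi mb bd.
  by apply: eq_integrable.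
Qed.

(** Two continuous representatives cannot differ at a point of [0, L]: they would
    differ on a nonempty open subinterval of (0, L), which has positive measure. *)
Lemma trace_eq {m n} (u w : R -> 'M[R]_(m, n)) x : 0 < L ->
  {within `[0, L], continuous w} -> ae_on L (fun t => w t = u t) ->
  x \in `[0, L] -> trace L u x = w x.
Proof.
move=> L0 wc wu xL.
rewrite /trace; case: xgetP => [a _|]; last first.
  by move=> /(_ (w x))[]; exists w.
move=> [w' [w'c w'u <-]]; apply/matrixP => i j.
have cw (v : R -> 'M[R]_(m, n)) : {within `[0, L], continuous v} ->
    {within `[0, L], continuous (fun t => v t i j)}.
  move=> vc t; exact: (@cvg_comp _ _ _ v (fun M : 'M[R]_(m, n) => M i j) _ _ _ (vc t) (@coord_continuous R m n i j (v t))).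
have dc : {within `[0, L], continuous (fun t => w' t i j - w t i j)}.
  by move=> t; apply: cvgB; [exact: (cw _ w'c)|exact: (cw _ wc)].
have d0 : ae_on L (fun t => w' t i j - w t i j = 0).
  by have := ae_on_and wu w'u; apply: ae_on_imp => t _ [-> ->]; rewrite subrr.
apply/eqP; rewrite -subr_eq0; apply: contrapT => /negP dx.
have e0 : 0 < `|w' x i j - w x i j| by rewrite normr_gt0.
move/subspace_continuousP : dc => /(_ x xL).
move=> /cvgrPdist_lt /(_ _ e0).
move=> [/= r r0 hr].
move: xL; rewrite in_itv /= => /andP[x0 xL].
pose lo := Num.max 0 (x - r); pose up := Num.min L (x + r).
have ab : lo < up.
  by rewrite lt_min !gt_max; apply/andP; split; apply/andP; split => //; lra.
have [N [mN N0 subN]] := d0.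
have : (mu `]lo, up[ <= mu N)%E.
  apply: le_measure; rewrite ?inE//.
  move=> t; rewrite /= in_itv/= lt_min gt_max => /andP[/andP[t0 tr] /andP[tL tr']].
  have tD : `]0, L[%classic t by rewrite /= in_itv/= t0.
  apply: subN => /= /(_ tD) dt.
  have tin : t \in `[0, L] by rewrite in_itv/= !ltW.
  have xt : `|x - t| < r by rewrite ltr_norml; apply/andP; split; lra.
  have : `|(w' x i j - w x i j) - (w' t i j - w t i j)| < `|w' x i j - w x i j|.
    exact: (hr t xt tin).
  by rewrite dt subr0 ltxx.
rewrite N0 lebesgue_measure_itv/= lte_fin ab -EFinD lee_fin; lra.
Qed.
End tail.

(** * Weak derivatives *)

Section weak.
Context {R : realType}.
Variable L : R.
Implicit Types u g e phi : R -> R.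

Lemma ae_on_forall (I : finType) (P : I -> R -> Prop) :
  (forall i, ae_on L (P i)) -> ae_on L (fun t => forall i, P i t).
Proof.
move=> h; have [s hs] : exists s : seq I, forall i, i \in s by exists (enum I) => i; rewrite mem_enum.
suff : ae_on L (fun t => forall i, i \in s -> P i t).
  by apply: ae_on_imp => t _ ht i; exact: ht.
elim: s {hs} => [|i s IH]; first exact: ae_onT.
have := ae_on_and (h i) IH; apply: ae_on_imp => t _ [hi ht] j.
by rewrite inE => /predU1P[->//|]; exact: ht.
Qed.

Lemma int1_add u g : L1fun L u -> L1fun L g ->
  int1 `]0, L[ (fun t => u t + g t) = int1 `]0, L[ u + int1 `]0, L[ g.
Proof. by move=> ui gi; rewrite /int1 RintegralD//; exact: measurable_interval. Qed.

Lemma int1_scale c u : L1fun L u ->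
  int1 `]0, L[ (fun t => c * u t) = c * int1 `]0, L[ u.
Proof. by move=> ui; rewrite /int1 RintegralZl//; exact: measurable_interval. Qed.

Lemma int1_opp u : L1fun L u -> int1 `]0, L[ (fun t => - u t) = - int1 `]0, L[ u.
Proof.
move=> ui; rewrite -mulN1r -int1_scale//.
by congr int1; apply/funext => t; rewrite mulN1r.
Qed.

Lemma smooth_expr_ess_bdd e : smooth_expr e -> ess_bdd L e.
Proof.
by move=> /smooth_expr_continuous ec; apply: continuous_ess_bdd; exact: continuous_subspaceT.
Qed.

Lemma derive1_is_derive f (x df : R) : is_derive x (1 : R) f df -> derive1 f x = df.
Proof. by move=> [_ <-]; rewrite derive1E. Qed.

Lemma smooth_expr_derive1 e : smooth_expr e ->
  smooth_expr (derive1 e) /\ forall x, is_derive x (1 : R) e (derive1 e x).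
Proof.
move=> /smooth_expr_derive [e' se' de].
have -> : derive1 e = e' by apply/funext => x; exact: derive1_is_derive.
by [].
Qed.

Lemma test_function_mul e phi : smooth_expr e ->
  test_function `]0, L[ phi -> test_function `]0, L[ (fun t => e t * phi t).
Proof.
move=> se [sphi cphi sub].
have sub' : closure [set x | e x * phi x != 0] `<=` closure [set x | phi x != 0].
  by apply: closureS => x /=; apply: contraNN => /eqP ->; rewrite mulr0.
split.
- by apply: smooth_expr_is_smooth; apply: smooth_expr_mul => //; exact: smooth_expr_smooth.
- by apply: (subclosed_compact _ cphi) => //; exact: closed_closure.
- exact: subset_trans sub.
Qed.

Lemma test_function_out phi x : test_function `]0, L[ phi -> ~ `]0, L[%classic x -> phi x = 0.
Proof.
move=> [_ _ sub] xD; apply/eqP; apply: contrapT => /negP phix; apply: xD.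
by apply: sub; apply: subset_closure.
Qed.

(** The scalar version of is_weak_deriv. *)
Definition weak_der u g : Prop :=
  [/\ L2fun L u, L2fun L g & forall phi, test_function `]0, L[ phi ->
    int1 `]0, L[ (fun t => u t * derive1 phi t) = - int1 `]0, L[ (fun t => g t * phi t)].

Lemma is_weak_derivP {m n} (u g : R -> 'M[R]_(m, n)) :
  is_weak_deriv L u g <-> forall i j, weak_der (fun t => u t i j) (fun t => g t i j).
Proof.
split=> [[ui gi h] i j|h].
  by split; [exact: ui|exact: gi|move=> phi tphi; exact: h].
split=> [i j|i j|phi tphi i j]; first by have [] := h i j.
  by have [] := h i j.
by have [_ _ ] := h i j; apply.
Qed.

Lemma weak_der_unique u g g' : weak_der u g -> weak_der u g' -> ae_on L (fun t => g t = g' t).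
Proof.
move=> [ui gi h] [_ gi' h'].
have di : L2fun L (fun t => g t + - g' t) by apply: L2fun_add => //; exact: L2fun_opp.
have : ae_on L (fun t => g t + - g' t = 0).
  apply: fundamental_lemma; first exact: L2fun_L1fun.
  move=> phi tphi.
  have sphi : L2fun L phi.
    by apply/ess_bdd_L2fun/smooth_expr_ess_bdd/smooth_expr_smooth; case: tphi.
  have -> : (fun t => (g t + - g' t) * phi t) = (fun t => g t * phi t + - (g' t * phi t)).
    by apply/funext => t; rewrite mulrDl mulNr.
  rewrite int1_add; last 2 first.
  - exact: L1fun_mul.
  - by have := L1fun_mul (L2fun_opp gi') sphi; congr L1fun; apply/funext => t; rewrite mulNr.
  rewrite int1_opp; last exact: L1fun_mul.
  by have := h _ tphi; rewrite h' // => /oppr_inj ->; rewrite subrr.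
by apply: ae_on_imp => t _ /eqP; rewrite subr_eq0 => /eqP.
Qed.

Lemma weak_der_add u g u' g' : weak_der u g -> weak_der u' g' ->
  weak_der (fun t => u t + u' t) (fun t => g t + g' t).
Proof.
move=> [ui gi h] [ui' gi' h']; split; [exact: L2fun_add|exact: L2fun_add|].
move=> phi tphi.
have sphi : smooth_expr phi by apply: smooth_expr_smooth; case: tphi.
have [sphi' _] := smooth_expr_derive1 sphi.
have iphi := ess_bdd_L2fun (smooth_expr_ess_bdd sphi).
have iphi' := ess_bdd_L2fun (smooth_expr_ess_bdd sphi').
have DE (a b c : R -> R) : (fun t => (a t + b t) * c t) = (fun t => a t * c t + b t * c t).
  by apply/funext => t; rewrite mulrDl.
rewrite !DE.
by rewrite !int1_add ?opprD ?h ?h'//; exact: L1fun_mul.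
Qed.

(** The product e * phi with a test function phi is again a test function, which
    turns the Leibniz rule for smooth functions into the one for weak derivatives. *)
Lemma weak_der_mul e u g : smooth_expr e -> weak_der u g ->
  weak_der (fun t => e t * u t) (fun t => derive1 e t * u t + e t * g t).
Proof.
move=> se [ui gi h].
have [se' de] := smooth_expr_derive1 se.
have be := smooth_expr_ess_bdd se; have be' := smooth_expr_ess_bdd se'.
have eui := L2fun_mul be ui; have e'ui := L2fun_mul be' ui.
have egi := L2fun_mul be gi.
split=> //; first exact: L2fun_add.
move=> phi tphi.
have sphi : smooth_expr phi by apply: smooth_expr_smooth; case: tphi.
have [sphi' dphi] := smooth_expr_derive1 sphi.
have iphi := ess_bdd_L2fun (smooth_expr_ess_bdd sphi).
have iphi' := ess_bdd_L2fun (smooth_expr_ess_bdd sphi').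
have dE : derive1 (fun t => e t * phi t) = (fun t => e t * derive1 phi t + derive1 e t * phi t).
  apply/funext => t; apply: derive1_is_derive.
  have := is_deriveM (de t) (dphi t).
  by rewrite /GRing.scale /= [phi t * _]mulrC.
have := h _ (test_function_mul se tphi).
rewrite dE.
have -> : (fun t => u t * (e t * derive1 phi t + derive1 e t * phi t)) =
    (fun t => e t * u t * derive1 phi t + derive1 e t * u t * phi t).
  by apply/funext => t; ring.
have -> : (fun t => g t * (e t * phi t)) = (fun t => e t * g t * phi t).
  by apply/funext => t; ring.
have -> : (fun t => (derive1 e t * u t + e t * g t) * phi t) =
    (fun t => derive1 e t * u t * phi t + e t * g t * phi t).
  by apply/funext => t; rewrite mulrDl.
by rewrite !int1_add; [lra|exact: L1fun_mul..].
Qed.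

Lemma weak_der0 : weak_der (cst 0) (cst 0).
Proof.
split; [exact: L2fun_cst|exact: L2fun_cst|move=> phi tphi].
have z f : int1 `]0, L[ (fun t => cst (0 : R) t * f t) = 0.
  rewrite (_ : (fun _ => _) = cst 0); last by apply/funext => t; rewrite mul0r.
  by rewrite /int1 Rintegral_cst ?mul0r//; exact: measurable_interval.
by rewrite !z oppr0.
Qed.

Lemma weak_der_sum (I : Type) (r : seq I) (u g : I -> R -> R) :
  (forall i, weak_der (u i) (g i)) ->
  weak_der (fun t => \sum_(i <- r) u i t) (fun t => \sum_(i <- r) g i t).
Proof.
move=> h; elim: r => [|i r IH].
  under eq_fun do rewrite big_nil; under [X in weak_der _ X]eq_fun do rewrite big_nil.
  exact: weak_der0.
under eq_fun do rewrite big_cons; under [X in weak_der _ X]eq_fun do rewrite big_cons.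
exact: weak_der_add.
Qed.

Lemma weak_derivP {m n} (u : R -> 'M[R]_(m, n)) : W12 L u -> is_weak_deriv L u (weak_deriv L u).
Proof. by move=> [g hg]; rewrite /weak_deriv; apply: (xgetPex (fun=> 0)); exists g. Qed.

Lemma weak_deriv_ae {m n} (u g : R -> 'M[R]_(m, n)) : is_weak_deriv L u g ->
  ae_on L (fun t => weak_deriv L u t = g t).
Proof.
move=> hg; have /is_weak_derivP h1 := weak_derivP (ex_intro _ g hg).
have /is_weak_derivP h2 := hg.
have : ae_on L (fun t => forall i j, weak_deriv L u t i j = g t i j).
  by apply: ae_on_forall => i; apply: ae_on_forall => j; exact: weak_der_unique (h1 i j) (h2 i j).
by apply: ae_on_imp => t _ h; apply/matrixP.
Qed.

Lemma is_weak_deriv_mulmx {m n k} (E : R -> 'M[R]_(m, n)) (u g : R -> 'M[R]_(n, k)) :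
  (forall i j, smooth_expr (fun t => E t i j)) -> is_weak_deriv L u g ->
  is_weak_deriv L (fun t => E t *m u t)
    (fun t => (\matrix_(i, j) derive1 (fun x => E x i j) t) *m u t + E t *m g t).
Proof.
move=> sE /is_weak_derivP h; apply/is_weak_derivP => i j.
have := weak_der_sum (index_enum 'I_n) (fun l => weak_der_mul (sE i l) (h l j)).
congr weak_der; apply/funext => t; rewrite !mxE//.
by rewrite -big_split /=; apply: eq_bigr => l _; rewrite !mxE.
Qed.

End weak.

(** * Axial matrices and rotations *)

Section vec.
Context {R : realType}.
Implicit Types (u v s w : 'cV[R]_3) (A : 'M[R]_3).

(** The literals 0, 1, 2 are elements of 'I_3, where addition is modulo 3. *)
Lemma ord3E (i : 'I_3) : i = 0 \/ i = 1 \/ i = 2.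
Proof.
by case: i => [[|[|[|//]]] hi]; [left|right;left|right;right]; apply: val_inj.
Qed.

Lemma ord3_sum (F : 'I_3 -> R) : \sum_i F i = F 0 + F 1 + F 2.
Proof.
rewrite !big_ord_recl big_ord0 addr0 addrA.
by congr (_ + _ + _); congr F; apply: val_inj.
Qed.

Let p11 : (1 + 1 : 'I_3) = 2. Proof. exact: val_inj. Qed.
Let p12 : (1 + 2 : 'I_3) = 0. Proof. exact: val_inj. Qed.
Let p21 : (2 + 1 : 'I_3) = 0. Proof. exact: val_inj. Qed.
Let p22 : (2 + 2 : 'I_3) = 1. Proof. exact: val_inj. Qed.
Let pE := (p11, p12, p21, p22, @add0r 'I_3).

Lemma crossE u v : [/\ cross u v 0 0 = u 1 0 * v 2 0 - u 2 0 * v 1 0,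
  cross u v 1 0 = u 2 0 * v 0 0 - u 0 0 * v 2 0 &
  cross u v 2 0 = u 0 0 * v 1 0 - u 1 0 * v 0 0].
Proof. by rewrite !mxE !pE. Qed.

Let axE s : ((axial_mx s 0 0 = 0) * (axial_mx s 0 1 = - s 2 0) * (axial_mx s 0 2 = s 1 0) *
  (axial_mx s 1 0 = s 2 0) * (axial_mx s 1 1 = 0) * (axial_mx s 1 2 = - s 0 0) *
  (axial_mx s 2 0 = - s 1 0) * (axial_mx s 2 1 = s 0 0) * (axial_mx s 2 2 = 0))%type.
Proof.
by do ![split]; rewrite !mxE ?pE /= ?(mulr1, mulr0, subr0, sub0r, oppr0).
Qed.

Let det22 (M : 'M[R]_2) : \det M = M 0 0 * M 1 1 - M 0 1 * M 1 0.
Proof.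
rewrite (expand_det_row _ 0) !big_ord_recl big_ord0 /cofactor !det_mx11 !mxE addr0 /=.
have l1 : lift (0 : 'I_2) (0 : 'I_1) = 1 by exact: val_inj.
have l2 : lift (1 : 'I_2) (0 : 'I_1) = 0 by exact: val_inj.
by rewrite l1 l2 /= expr0 expr1 mul1r mulN1r mulrN.
Qed.

Lemma cof33 A (k j : 'I_3) : cofactor A k j =
  A (k + 1) (j + 1) * A (k + 2) (j + 2) - A (k + 1) (j + 2) * A (k + 2) (j + 1).
Proof.
pose A' (a b : nat) := A (inord a) (inord b).
have AE a b : A a b = A' a b by rewrite /A' !inord_val.
rewrite /cofactor (_ : \det _ = (row' k (col' j A)) 0 0 * (row' k (col' j A)) 1 1 -
   (row' k (col' j A)) 0 1 * (row' k (col' j A)) 1 0); last exact: det22.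
rewrite !mxE !AE.
case: (ord3E k) => [->|[->|->]]; case: (ord3E j) => [->|[->|->]]; rewrite !pE /= /bump /=; ring.
Qed.

(** A matrix of determinant 1 whose inverse is its transpose equals its own
    cofactor matrix. *)
Lemma SO3_cof A (k j : 'I_3) : SO3 A -> A k j =
  A (k + 1) (j + 1) * A (k + 2) (j + 2) - A (k + 1) (j + 2) * A (k + 2) (j + 1).
Proof.
move=> [AA dA]; rewrite -cof33.
have : \adj A = A^T by rewrite -[LHS]mul1mx -AA -mulmxA mul_mx_adj dA mulmx1.
by move=> /matrixP/(_ j k); rewrite !mxE => ->.
Qed.

Lemma axial_mxZ (a : R) s : axial_mx (a *: s) = a *: axial_mx s.
Proof. by apply/matrixP => i j; rewrite !mxE; ring. Qed.

Lemma axial_mxD s w : axial_mx (s + w) = axial_mx s + axial_mx w.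
Proof. by apply/matrixP => i j; rewrite !mxE; ring. Qed.

Lemma axial_mxT s : (axial_mx s)^T = - axial_mx s.
Proof.
apply/matrixP => i j; rewrite mxE [RHS]mxE.
by case: (ord3E i) => [->|[->|->]]; case: (ord3E j) => [->|[->|->]];
  rewrite !axE ?oppr0 ?opprK.
Qed.

(** For any A, the matrix A^T [s] A is the axial matrix of cof(A)^T s, and
    cof(A) = A on SO(3). *)
Lemma axial_mx_conj A s : SO3 A -> A^T *m axial_mx s *m A = axial_mx (A^T *m s).
Proof.
move=> hA.
pose cof k j := A (k + 1) (j + 1) * A (k + 2) (j + 2) - A (k + 1) (j + 2) * A (k + 2) (j + 1).
have g k : (A^T *m s) k 0 = cof 0 k * s 0 0 + cof 1 k * s 1 0 + cof 2 k * s 2 0.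
  by rewrite mxE ord3_sum !mxE; congr (_ * _ + _ * _ + _ * _); exact: SO3_cof.
have tE (a b : 'I_3) : A^T a b = A b a by rewrite mxE.
have mE (B C : 'M[R]_3) a b : (B *m C) a b = B a 0 * C 0 b + B a 1 * C 1 b + B a 2 * C 2 b.
  by rewrite mxE ord3_sum.
apply/matrixP => i j.
by case: (ord3E i) => [->|[->|->]]; case: (ord3E j) => [->|[->|->]];
  rewrite !mE !tE !axE ?g /cof ?pE; ring.
Qed.

Lemma axial_mx_cube s : axial_mx s *m axial_mx s *m axial_mx s = - dot s s *: axial_mx s.
Proof.
have mE (B C : 'M[R]_3) a b : (B *m C) a b = B a 0 * C 0 b + B a 1 * C 1 b + B a 2 * C 2 b.
  by rewrite mxE ord3_sum.
have zE (c : R) (B : 'M[R]_3) a b : (c *: B) a b = c * B a b by rewrite mxE.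
apply/matrixP => i j; rewrite zE /dot ord3_sum.
by case: (ord3E i) => [->|[->|->]]; case: (ord3E j) => [->|[->|->]]; rewrite !mE !axE; ring.
Qed.

Lemma dotE u v : dot u v = (u^T *m v) 0 0.
Proof. by rewrite mxE; apply: eq_bigr => k _; rewrite mxE. Qed.

Lemma dotC u v : dot u v = dot v u.
Proof. by apply: eq_bigr => k _; rewrite mulrC. Qed.

Lemma dot_mulmx A u v : dot (A *m u) v = dot u (A^T *m v).
Proof. by rewrite !dotE trmx_mul mulmxA. Qed.

Lemma dotDl u v w : dot (u + v) w = dot u w + dot v w.
Proof. by rewrite /dot -big_split; apply: eq_bigr => k _; rewrite mxE mulrDl. Qed.

Lemma dotZl a u w : dot (a *: u) w = a * dot u w.
Proof. by rewrite /dot mulr_sumr; apply: eq_bigr => k _; rewrite mxE mulrA. Qed.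

Lemma dotDr u v w : dot u (v + w) = dot u v + dot u w.
Proof. by rewrite dotC dotDl !(dotC u). Qed.

Lemma dotZr a u w : dot u (a *: w) = a * dot u w.
Proof. by rewrite dotC dotZl dotC. Qed.

Lemma dot_axial s u v : dot u (axial_mx s *m v) = dot s (cross v u).
Proof.
have [c0 c1 c2] := crossE v u; have [d0 d1 d2] := crossE s v.
by rewrite axial_mxE /dot !ord3_sum c0 c1 c2 d0 d1 d2; ring.
Qed.

Lemma dot_delta (k : 'I_3) u : dot u (delta_mx k 0) = u k 0.
Proof.
rewrite /dot (bigD1 k) //= big1 ?addr0; first by rewrite mxE !eqxx mulr1.
by move=> i /negPf nik; rewrite mxE nik mulr0.
Qed.
End vec.

Section exponential.
Context {R : realType}.

(** Rodrigues' formula. *)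
Definition rotation (A : 'M[R]_3) (a : R) : 'M[R]_3 :=
  1%:M + sin a *: A + (1 - cos a) *: (A *m A).

Lemma cube_expr (A : 'M[R]_3) m : A * A * A = - A ->
  A ^+ m.*2.+1 = (-1) ^+ m *: A /\ A ^+ m.*2.+2 = (-1) ^+ m *: (A * A).
Proof.
move=> A3; elim: m => [|m [IH1 IH2]].
  by rewrite /= !expr0 !scale1r expr1 expr2.
have h1 : A ^+ m.+1.*2.+1 = (-1) ^+ m.+1 *: A.
  by rewrite doubleS exprS IH2 -scalerAr mulrA A3 scalerN exprS mulN1r scaleNr.
by rewrite h1; split=> //; rewrite exprS h1 -scalerAr.
Qed.

(** From A^3 = - A the odd powers of A are +-A and the even ones +-A^2, and the
    exponential series splits into those of the sine and the cosine. *)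
Lemma mexp_rotation (A : 'M[R]_3) (a : R) : A *m A *m A = - A ->
  mexp (a *: A) = rotation A a.
Proof.
rewrite /rotation !mulmxE => A3.
(* The term of index 0 is 1 instead of - A^2; the last summand accounts for it. *)
have termE k : (k`!%:R^-1 : R) *: (a *: A) ^+ k =
    sin_coeff a k *: A + (- cos_coeff a k) *: (A * A) + (k == 0%N)%:R *: (1 + A * A).
  have even_or_odd : k = 0%N \/ (exists m, k = m.*2.+1) \/ (exists m, k = m.*2.+2).
    case: k => [|k]; first by left.
    right; rewrite -(odd_double_half k); case: (odd k); last by left; exists k./2.
    by right; exists k./2.
  rewrite exprZn scalerA /sin_coeff /cos_coeff /= -exprnP.
  case: even_or_odd => [->|[[m ->]|[m ->]]].
  - by rewrite /= !expr0 fact0 invr1 !mul1r !mul0r scale0r add0r scaleN1r !scale1r addrC addrK.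
  - have [-> _] := cube_expr m A3.
    rewrite oddS odd_double /= half_double mul1r !mul0r oppr0 !scale0r !addr0 scalerA.
    by congr (_ *: _); ring.
  - have [_ ->] := cube_expr m A3.
    rewrite !oddS odd_double /= uphalf_double mul1r !mul0r !scale0r addr0 add0r scalerA.
    by congr (_ *: _); rewrite doubleK [(-1) ^+ m.+1]exprS; ring.
pose F n := series (sin_coeff a) n *: A + (- series (cos_coeff a) n) *: (A * A) +
  (0 < n)%:R *: (1 + A * A).
have FE : series (fun k => (k`!%:R^-1 : R) *: (a *: A) ^+ k) = F.
  apply/funext => n; rewrite /F /series /=.
  under eq_bigr do rewrite termE.
  rewrite !big_split /= -!scaler_suml; congr (_ + _ + _).
    by rewrite sumrN.
  congr (_ *: _); case: n => [|n]; first by rewrite big_geq.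
  by rewrite big_nat_recl//= big1 ?addr0.
rewrite /mexp FE.
have -> : 1%:M + sin a *: A + (1 - cos a) *: (A * A) =
    sin a *: A + (- cos a) *: (A * A) + 1 *: (1 + A * A).
  by rewrite scalerBl !scale1r scaleNr [RHS]addrC -!addrA; congr (_ + _); rewrite addrCA.
apply: cvg_lim; first exact: norm_hausdorff.
apply: cvgD; first apply: cvgD.
- apply: cvgZr_tmp; rewrite unlock; exact: is_cvg_series_sin_coeff.
- apply: cvgZr_tmp; apply: cvgN; rewrite unlock; exact: is_cvg_series_cos_coeff.
- apply: cvgZr_tmp; apply: cvg_near_cst; near=> n.
  have -> // : (0 < n)%N by near: n; exact: nbhs_infty_gt.
Unshelve. all: by end_near.
Qed.

(** Two applications of the mean value theorem each; the bounds
    make the load term of the energy differentiable at eps = 0. *)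
Lemma sin_cos_bounds (x : R) : `|sin x - x| <= x ^+ 2 /\ `|1 - cos x| <= x ^+ 2.
Proof.
wlog x0 : x / 0 <= x => [hw|].
  have [/hw//|/ltW x0] := leP 0 x.
  have := hw (- x); rewrite oppr_ge0 => /(_ x0).
  by rewrite sinN cosN sqrrN -opprD normrN.
have mvt (f df : R -> R) (y : R) : 0 <= y -> (forall z, is_derive z (1 : R) f (df z)) ->
    exists2 c, 0 <= c <= y & f y - f 0 = df c * y.
  move=> y0 fd.
  have fc : {within `[0, y], continuous f}.
    by apply: continuous_subspaceT => z; apply: differentiable_continuous;
      apply/derivable1_diffP; have [] := fd z.
  have [c cin fE] := MVT_segment y0 (fun z _ => fd z) fc.
  by exists c; rewrite ?fE ?subr0//; move: cin; rewrite in_itv.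
have cos1 (y : R) : 0 <= y -> `|1 - cos y| <= y.
  move=> y0; have [c /andP[c0 cy]] := mvt _ _ _ y0 (@is_derive_cos R).
  rewrite cos0 => h; rewrite distrC h normrM (ger0_norm y0) ler_piMl//.
  by rewrite normrN sin_max.
have sin1 (y : R) : 0 <= y -> `|sin y| <= y.
  move=> y0; have [c /andP[c0 cy]] := mvt _ _ _ y0 (@is_derive_sin R).
  rewrite sin0 subr0 => ->; rewrite normrM (ger0_norm y0) ler_piMl//.
  exact: cos_max.
split.
- have dsin z : is_derive z (1 : R) (fun y => sin y - y) (cos z - 1).
    by apply: is_deriveB.
  have [c /andP[c0 cx]] := mvt _ _ _ x0 dsin.
  rewrite sin0 !subr0 => ->; rewrite normrM (ger0_norm x0) expr2 ler_wpM2r//.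
  by rewrite distrC (le_trans (cos1 _ c0)).
- have [c /andP[c0 cx]] := mvt _ _ _ x0 (@is_derive_cos R).
  rewrite cos0 => h; rewrite distrC h normrM (ger0_norm x0) expr2 ler_wpM2r//.
  by rewrite normrN (le_trans (sin1 _ c0)).
Qed.

End exponential.

Section rotation.
Context {R : realType}.
Implicit Type A : 'M[R]_3.

(** Multiplication in the commutative algebra spanned by 1, A and A^2. *)
Lemma mul_cube_expr A (x y x' y' : R) : A *m A *m A = - A ->
  (1%:M + x *: A + y *: (A *m A)) *m (1%:M + x' *: A + y' *: (A *m A)) =
  1%:M + (x + x' - x * y' - y * x') *: A + (y + y' + x * x' - y * y') *: (A *m A).
Proof.
move=> A3; set B := A *m A in A3 *.
have AB : A *m B = - A by rewrite -A3 /B mulmxA.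
have BB : B *m B = - B by rewrite {2}/B mulmxA A3 mulNmx.
rewrite !mulmxDl !mulmxDr !mul1mx !mulmx1 -!scalemxAl -!scalemxAr AB A3 BB -/B.
by apply/matrixP => i j; rewrite !mxE; ring.
Qed.

Lemma rotation_commute A a : A *m rotation A a = rotation A a *m A.
Proof.
by rewrite /rotation !mulmxDl !mulmxDr mul1mx mulmx1 -!scalemxAl -!scalemxAr mulmxA.
Qed.

Lemma rotation_orth A a : A *m A *m A = - A -> A^T = - A ->
  (rotation A a)^T *m rotation A a = 1%:M.
Proof.
move=> A3 AT.
have -> : (rotation A a)^T = 1%:M + - sin a *: A + (1 - cos a) *: (A *m A).
  rewrite /rotation !linearD /= !linearZ /= trmx_mul trmx1 AT mulNmx mulmxN opprK.
  by rewrite scalerN -scaleNr.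
rewrite /rotation mul_cube_expr//.
have sc := cos2Dsin2 a.
have -> : - sin a + sin a - - sin a * (1 - cos a) - (1 - cos a) * sin a = 0 by ring.
have -> : 1 - cos a + (1 - cos a) + - sin a * sin a - (1 - cos a) * (1 - cos a) = 0.
  rewrite -(subrr (1 : R)) -{2}sc; ring.
by rewrite !scale0r !addr0.
Qed.

Lemma rotationE A a i j : rotation A a i j =
  (1%:M : 'M[R]_3) i j + A i j * sin a + (A *m A) i j * (1 - cos a).
Proof. by rewrite /rotation !mxE; ring. Qed.

Lemma rotation_smooth A (c : R) (phi : R -> R) i j : smooth_expr phi ->
  smooth_expr (fun t => rotation A (c * phi t) i j).
Proof.
move=> sphi.
have sc : smooth_expr (fun t => c * phi t).
  exact: (smooth_expr_mul (smooth_expr_cst c)).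
have -> : (fun t => rotation A (c * phi t) i j) = (fun t =>
    (cst ((1%:M : 'M[R]_3) i j) t + (sin \o (fun t => c * phi t)) t * cst (A i j) t) +
    (cst 1 t + cst (- 1) t * (cos \o (fun t => c * phi t)) t) * cst ((A *m A) i j) t).
  apply/funext => t; rewrite rotationE /=; ring.
have ss := smooth_expr_comp smooth_expr_sin sc.
have sco := smooth_expr_comp smooth_expr_cos sc.
by repeat first [exact: smooth_expr_cst | exact: ss | exact: sco
  | apply: smooth_expr_add | apply: smooth_expr_mul].
Qed.

Lemma rotation_derive A (c : R) (phi : R -> R) t : A *m A *m A = - A -> smooth_expr phi ->
  \matrix_(i, j) derive1 (fun x => rotation A (c * phi x) i j) t =
  (c * derive1 phi t) *: (A *m rotation A (c * phi t)).
Proof.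
move=> A3 sphi; have [_ dphi] := smooth_expr_derive1 sphi.
have dc : is_derive t (1 : R) (fun x => c * phi x) (c * derive1 phi t).
  exact: (is_deriveZ c (dphi t)).
have ds := @is_derive1_comp _ sin (fun x => c * phi x) t _ _ (is_derive_sin _) dc.
have dco := @is_derive1_comp _ cos (fun x => c * phi x) t _ _ (is_derive_cos _) dc.
have -> : A *m rotation A (c * phi t) = cos (c * phi t) *: A + sin (c * phi t) *: (A *m A).
  rewrite /rotation !mulmxDr mulmx1 -!scalemxAr mulmxA A3.
  by apply/matrixP => i j; rewrite !mxE; ring.
apply/matrixP => i j; rewrite mxE.
under eq_fun do rewrite rotationE.
rewrite [RHS]mxE [X in _ * X]mxE [X in _ * (X + _)]mxE [X in _ * (_ + X)]mxE.
move: (A i j) ((A *m A) i j) ((1%:M : 'M[R]_3) i j) => x1 x2 x0.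
apply: derive1_is_derive.
have h := is_deriveD (is_deriveD (is_derive_cst x0 t (1 : R))
  (is_deriveZ x1 ds)) (is_deriveZ x2 (is_deriveB (is_derive_cst (1 : R) t (1 : R)) dco)).
apply: (is_derive_eq h).
rewrite -[LHS]/(0 + x1 * (cos (c * phi t) * (c * derive1 phi t)) +
    x2 * (0 - - sin (c * phi t) * (c * derive1 phi t))); ring.
Qed.

End rotation.

(** * The energy along a one-parameter variation *)

Section matrix_classes.
Context {R : realType}.
Variable L : R.

Definition ess_bdd_mx {m n} (u : R -> 'M[R]_(m, n)) :=
  forall i j, ess_bdd L (fun t => u t i j).

Lemma ess_bdd_mx_L2 {m n} (u : R -> 'M[R]_(m, n)) : ess_bdd_mx u -> L2 L u.
Proof. by move=> bu i j; exact: ess_bdd_L2fun. Qed.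

Lemma ess_bdd_mx_cst {m n} (A : 'M[R]_(m, n)) : ess_bdd_mx (cst A).
Proof. by move=> i j; exact: ess_bdd_cst. Qed.

Lemma ess_bdd_mx_tr {m n} (u : R -> 'M[R]_(m, n)) : ess_bdd_mx u ->
  ess_bdd_mx (fun t => (u t)^T).
Proof. by move=> bu i j; under eq_fun do rewrite mxE; exact: bu. Qed.

Lemma ess_bdd_mx_mul {m n k} (u : R -> 'M[R]_(m, n)) (v : R -> 'M[R]_(n, k)) :
  ess_bdd_mx u -> ess_bdd_mx v -> ess_bdd_mx (fun t => u t *m v t).
Proof.
move=> bu bv i j; under eq_fun do rewrite mxE.
by apply: ess_bdd_sum => l; exact: ess_bdd_mul.
Qed.

Lemma L2_mul {m n k} (u : R -> 'M[R]_(m, n)) (v : R -> 'M[R]_(n, k)) :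
  ess_bdd_mx u -> L2 L v -> L2 L (fun t => u t *m v t).
Proof.
move=> bu bv i j; rewrite -/(L2fun L _); under eq_fun do rewrite mxE.
by apply: L2fun_sum => l; apply: L2fun_mul; [exact: bu|exact: bv].
Qed.

Lemma ess_bdd_mx_scale {m n} (f : R -> R) (u : R -> 'M[R]_(m, n)) :
  ess_bdd L f -> ess_bdd_mx u -> ess_bdd_mx (fun t => f t *: u t).
Proof. by move=> bf bu i j; under eq_fun do rewrite mxE; exact: ess_bdd_mul. Qed.

Lemma L1fun_add (u v : R -> R) : L1fun L u -> L1fun L v -> L1fun L (fun t => u t + v t).
Proof. by move=> ui vi; have := integrableD (@measurable_interval R L) ui vi. Qed.

Lemma L1fun_scale c (u : R -> R) : L1fun L u -> L1fun L (fun t => c * u t).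
Proof. by move=> ui; have := integrableZl (@measurable_interval R L) c ui. Qed.

Lemma L1fun_dot (u v : R -> 'cV[R]_3) : L2 L u -> L2 L v -> L1fun L (fun t => dot (u t) (v t)).
Proof.
move=> ui vi.
rewrite (_ : (fun t => _) = (fun t => u t 0 0 * v t 0 0 + u t 1 0 * v t 1 0 + u t 2 0 * v t 2 0)).
  by apply: L1fun_add; [apply: L1fun_add|]; apply: L1fun_mul; (exact: ui || exact: vi).
by apply/funext => t; rewrite /dot ord3_sum.
Qed.

Lemma ess_bdd_dot (u v : R -> 'cV[R]_3) : ess_bdd_mx u -> ess_bdd_mx v ->
  ess_bdd L (fun t => dot (u t) (v t)).
Proof. by move=> bu bv; apply: ess_bdd_sum => l; exact: ess_bdd_mul. Qed.

Lemma ess_bdd_cross (u v : R -> 'cV[R]_3) : ess_bdd_mx u -> ess_bdd_mx v ->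
  ess_bdd_mx (fun t => cross (u t) (v t)).
Proof.
move=> bu bv i j; under eq_fun do rewrite mxE.
by apply: ess_bdd_add; [|apply: ess_bdd_opp]; exact: ess_bdd_mul.
Qed.

Lemma SO3_le1 (A : 'M[R]_3) i j : SO3 A -> `|A i j| <= 1.
Proof.
move=> [/matrixP/(_ j j) + _]; rewrite !mxE eqxx ord3_sum !mxE /= -!expr2 mulr1n => h.
have := sqr_ge0 (A 0 j); have := sqr_ge0 (A 1 j); have := sqr_ge0 (A 2 j) => a2 a1 a0.
rewrite -(@expr_le1 _ 2)// real_normK ?num_real//.
by case: (ord3E i) => [->|[->|->]]; lra.
Qed.

Lemma SO3_bdd (rot : R -> 'M[R]_3) : W12_SO3 L rot -> ess_bdd_mx rot.
Proof.
move=> [[g [rL2 _ _]] hrot] i j; split; first by have [] := rL2 i j.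
by exists 1; apply: ae_on_imp hrot => t _ /SO3_le1.
Qed.

Lemma int1_bound (f g : R -> R) : L1fun L f -> L1fun L g ->
  (forall t, `|f t| <= g t) -> `|int1 `]0, L[ f| <= int1 `]0, L[ g.
Proof.
move=> fi gi fg; have mD := @measurable_interval R L.
apply: (@le_trans _ _ (int1 `]0, L[ (fun t => `|f t|))).
  exact: (le_normr_Rintegral mD fi).
apply: le_Rintegral => //; exact: (integrable_norm fi).
Qed.

End matrix_classes.

Section rod.
Context {R : realType}.
Variables (L : R) (Qf : 'M[R]_3 -> R) (H : 'M[R]_3) (rot : R -> 'M[R]_3) (s p : R -> 'cV[R]_3).
Hypothesis HT : H^T = H.
Hypothesis QfE : forall a, Qf (axial_mx a) = dot (H *m a) a.
Hypothesis rotW : W12_SO3 L rot.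
Hypothesis sL2 : L2 L s.
Hypothesis sE : ae_on L (fun t => (rot t)^T *m weak_deriv L rot t = axial_mx (s t)).
Hypothesis pb : ess_bdd_mx L p.

(** The contribution of one rod to the energy, for an abstract density Qf. *)
Definition rod_functional (u : R -> 'M[R]_3) : R :=
  2^-1 * int1 `]0, L[ (fun t => Qf ((u t)^T *m weak_deriv L u t))
  - int1 `]0, L[ (fun t => dot (p t) (u t *m e1)).

(** Only variations about a fixed axis are used: for these the exponential is a
    one-parameter group evaluated at eps * phi t, so that its derivative in t is
    explicit. Three axes suffice to recover the vector equation. *)
Definition variation (k : 'I_3) (phi : R -> R) (eps : R) (t : R) : 'M[R]_3 :=
  mexp (eps *: axial_mx (phi t *: delta_mx k 0)) *m rot t.

Let rotb : ess_bdd_mx L rot. Proof. exact: SO3_bdd. Qed.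

Lemma axial_delta_cube (k : 'I_3) (A := axial_mx (delta_mx k 0 : 'cV[R]_3)) :
  A *m A *m A = - A.
Proof. by rewrite /A axial_mx_cube dot_delta mxE !eqxx scaleN1r. Qed.

Lemma variationE k phi eps t :
  variation k phi eps t = rotation (axial_mx (delta_mx k 0)) (eps * phi t) *m rot t.
Proof. by rewrite /variation axial_mxZ scalerA mexp_rotation// axial_delta_cube. Qed.

(** With E the rotation of angle eps * phi about the axis e_k, E' = eps phi' A E and
    E commutes with A, so that (E R)^T (E R)' = R^T R' + eps phi' R^T A R. The
    strain therefore depends on eps in an affine way. *)
Lemma variation_strain k phi eps : smooth_expr phi ->
  ae_on L (fun t => (variation k phi eps t)^T *m weak_deriv L (variation k phi eps) t =
    axial_mx (s t + eps *: (derive1 phi t *: ((rot t)^T *m delta_mx k 0)))).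
Proof.
move=> sphi; set A := axial_mx (delta_mx k 0 : 'cV[R]_3).
have A3 : A *m A *m A = - A by exact: axial_delta_cube.
have AT : A^T = - A by exact: axial_mxT.
have sE' (i j : 'I_3) : smooth_expr (fun t => rotation A (eps * phi t) i j).
  exact: rotation_smooth.
have [rW rSO] := rotW.
have := weak_deriv_ae (is_weak_deriv_mulmx sE' (weak_derivP rW)).
have -> : (fun t => rotation A (eps * phi t) *m rot t) = variation k phi eps.
  by apply/funext => t; rewrite variationE.
move=> wE; have := ae_on_and wE (ae_on_and rSO sE).
apply: ae_on_imp => t _ [-> [rSOt st]].
rewrite rotation_derive// variationE -/A trmx_mul mulmxDr.
set E := rotation A _.
have EE : E^T *m E = 1%:M by exact: rotation_orth.
have -> : (rot t)^T *m E^T *m (E *m weak_deriv L rot t) = axial_mx (s t).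
  by rewrite -st -mulmxA [E^T *m _]mulmxA EE mul1mx.
have -> : (rot t)^T *m E^T *m (eps * derive1 phi t *: (A *m E) *m rot t) =
   (eps * derive1 phi t) *: ((rot t)^T *m A *m rot t).
  rewrite -scalemxAl -scalemxAr rotation_commute -!mulmxA [E^T *m _]mulmxA EE mul1mx.
  by [].
by rewrite /A axial_mx_conj// addrC axial_mxD !scalerA axial_mxZ.
Qed.

(** The stored energy is an exact quadratic polynomial in eps because the strain
    is affine in eps. The load term involves sin (eps phi) and cos (eps phi), whose
    deviation from eps phi and 1 is bounded by (eps phi)^2. *)
Lemma rod_expansion k phi : smooth_expr phi -> exists c0 C, forall eps,
  `|rod_functional (variation k phi eps) - c0 - eps *
    (int1 `]0, L[ (fun t => derive1 phi t * (rot t *m H *m s t) k 0)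
     - int1 `]0, L[ (fun t => phi t * cross (rot t *m e1) (p t) k 0))| <= C * eps ^+ 2.
Proof.
move=> sphi.
have [sphi' dphi] := smooth_expr_derive1 sphi.
have bphi := smooth_expr_ess_bdd L sphi.
have bphi' := smooth_expr_ess_bdd L sphi'.
pose W t := derive1 phi t *: ((rot t)^T *m delta_mx k 0) : 'cV[R]_3.
have Wb : ess_bdd_mx L W.
  apply: ess_bdd_mx_scale => //; apply: ess_bdd_mx_mul; last exact: ess_bdd_mx_cst.
  exact: ess_bdd_mx_tr.
have WL2 := ess_bdd_mx_L2 Wb.
have HL2 u : L2 L u -> L2 L (fun t => H *m u t : 'cV[R]_3).
  by move=> ui; apply: L2_mul => //; exact: ess_bdd_mx_cst.
pose a0 := int1 `]0, L[ (fun t => dot (H *m s t) (s t)).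
pose a1 := int1 `]0, L[ (fun t => dot (H *m s t) (W t)).
pose a2 := int1 `]0, L[ (fun t => dot (H *m W t) (W t)).
have i0 := L1fun_dot (HL2 _ sL2) sL2.
have i1 := L1fun_dot (HL2 _ sL2) WL2.
have i2 := L1fun_dot (HL2 _ WL2) WL2.
have stored eps : int1 `]0, L[ (fun t => Qf ((variation k phi eps t)^T *m
     weak_deriv L (variation k phi eps) t)) = a0 + (2 * eps) * a1 + eps ^+ 2 * a2.
  rewrite -!int1_scale// -!int1_add//; try (by repeat first [apply: L1fun_add|apply: L1fun_scale]).
  apply: int1_ae; apply: ae_on_imp (variation_strain k eps sphi) => t _ ->.
  rewrite QfE -/(W t); move: (s t) (W t) => st wt.
  rewrite mulmxDr -scalemxAr !dotDl !dotDr !dotZl !dotZr.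
  have -> : dot (H *m wt) st = dot (H *m st) wt by rewrite dot_mulmx HT dotC.
  ring.
have a1E : a1 = int1 `]0, L[ (fun t => derive1 phi t * (rot t *m H *m s t) k 0).
  apply: eq_Rintegral => t _; rewrite /W dotZr; congr (_ * _).
  by rewrite -[RHS]dot_delta -mulmxA [RHS]dot_mulmx.
set A := axial_mx (delta_mx k 0 : 'cV[R]_3).
pose g0 t := dot (p t) (rot t *m e1).
pose g1 t := dot (p t) (A *m (rot t *m e1)).
pose g2 t := dot (p t) (A *m (A *m (rot t *m e1))).
have re1 : ess_bdd_mx L (fun t => rot t *m e1 : 'cV[R]_3).
  by apply: ess_bdd_mx_mul => //; exact: ess_bdd_mx_cst.
have Ab u : ess_bdd_mx L u -> ess_bdd_mx L (fun t => A *m u t : 'cV[R]_3).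
  by move=> ub; apply: ess_bdd_mx_mul => //; exact: ess_bdd_mx_cst.
have b0 : ess_bdd L g0 by exact: ess_bdd_dot.
have b1 : ess_bdd L g1 by apply: ess_bdd_dot => //; exact: Ab.
have b2 : ess_bdd L g2 by apply: ess_bdd_dot => //; exact: (Ab _ (Ab _ re1)).
have bi (f : R -> R) : ess_bdd L f -> L1fun L f by move=> /ess_bdd_L2fun/L2fun_L1fun.
have bnorm (f : R -> R) : ess_bdd L f -> ess_bdd L (fun t => `|f t|).
  move=> [mf [C hC]]; split; first exact: measurableT_comp.
  by exists C; apply: ae_on_imp hC => t _; rewrite normr_id.
have bsin eps : ess_bdd L (fun t => sin (eps * phi t)).
  apply: (@smooth_expr_ess_bdd _ _ (sin \o (fun t => cst eps t * phi t))).
  apply: smooth_expr_comp; first exact: smooth_expr_sin.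
  by apply: smooth_expr_mul => //; exact: smooth_expr_cst.
have bcos eps : ess_bdd L (fun t => 1 - cos (eps * phi t)).
  apply: ess_bdd_add; first exact: (ess_bdd_cst L 1).
  apply: ess_bdd_opp.
  apply: (@smooth_expr_ess_bdd _ _ (cos \o (fun t => cst eps t * phi t))).
  apply: smooth_expr_comp; first exact: smooth_expr_cos.
  by apply: smooth_expr_mul => //; exact: smooth_expr_cst.
(* g1 and g2 are the coefficients of sin and 1 - cos in the load density, by
   Rodrigues' formula. *)
have bremainder eps : ess_bdd L (fun t => (sin (eps * phi t) - eps * phi t) * g1 t +
      (1 - cos (eps * phi t)) * g2 t).
  apply: ess_bdd_add; apply: ess_bdd_mul => //.
  apply: ess_bdd_add => //; apply: ess_bdd_opp; apply: ess_bdd_mul => //.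
  exact: (ess_bdd_cst L eps).
have loadE eps : int1 `]0, L[ (fun t => dot (p t) (variation k phi eps t *m e1)) =
    int1 `]0, L[ g0 + eps * int1 `]0, L[ (fun t => phi t * g1 t) +
    int1 `]0, L[ (fun t => (sin (eps * phi t) - eps * phi t) * g1 t +
      (1 - cos (eps * phi t)) * g2 t).
  have b3 : ess_bdd L (fun t => phi t * g1 t) by exact: ess_bdd_mul.
  rewrite -(int1_scale _ (bi _ b3)) -(int1_add (bi _ b0) (L1fun_scale eps (bi _ b3))).
  rewrite -(int1_add _ (bi _ (bremainder eps))); last first.
    by apply: L1fun_add; [exact: bi|apply: L1fun_scale; exact: bi].
  apply: eq_Rintegral => t _; rewrite variationE -/A /rotation !mulmxDl mul1mx -!scalemxAl.
  rewrite -!mulmxA !dotDr !dotZr -/(g0 t) -/(g1 t) -/(g2 t); ring.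
pose B := int1 `]0, L[ (fun t => phi t ^+ 2 * (`|g1 t| + `|g2 t|)).
exists (2^-1 * a0 - int1 `]0, L[ g0), (2^-1 * `|a2| + B) => eps.
rewrite /rod_functional stored loadE -a1E.
have -> : int1 `]0, L[ (fun t => phi t * cross (rot t *m e1) (p t) k 0) =
    int1 `]0, L[ (fun t => phi t * g1 t).
  by apply: eq_Rintegral => t _; rewrite /g1 dot_axial dotC dot_delta.
set r := int1 _ (fun t => _ + _ * g2 t).
have b4 : ess_bdd L (fun t => phi t ^+ 2 * (`|g1 t| + `|g2 t|)).
  by apply: ess_bdd_mul; [exact: ess_bdd_mul|apply: ess_bdd_add; exact: bnorm].
have rB : `|r| <= eps ^+ 2 * B.
  rewrite /B -(int1_scale _ (bi _ b4)).
  apply: int1_bound; [exact: bi|apply: L1fun_scale; exact: bi|move=> t].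
  have [hs hc] := sin_cos_bounds (eps * phi t).
  apply: (le_trans (ler_normD _ _)); rewrite !normrM mulrA -exprMn mulrDr.
  by apply: lerD; apply: ler_wpM2r.
set b1' := int1 _ _.
rewrite (_ : _ - _ = 2^-1 * eps ^+ 2 * a2 - r); last by field.
apply: (le_trans (ler_normB _ _)); rewrite mulrDl; apply: lerD; last by rewrite mulrC.
by rewrite normrM normrM (ger0_norm (sqr_ge0 eps)) ger0_norm// mulrAC.
Qed.

End rod.

(** A quadratic remainder bound at all eps determines both the value and the
    derivative at 0. *)
Lemma derive_expansion {R : realType} (J : R -> R) (c0 b C d : R) :
  (forall eps, `|J eps - c0 - eps * b| <= C * eps ^+ 2) ->
  is_derive (0 : R) (1 : R) J d -> d = b.
Proof.
move=> hJ [dJ <-].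
have J0 : J 0 = c0.
  have := hJ 0; rewrite expr0n /= mulr0 mul0r subr0 normr_le0 subr_eq0.
  by move/eqP.
apply: cvg_lim => //; apply/cvgrPdist_le => e e0; near=> h.
have h0 : h != 0 by near: h; exact: nbhs_dnbhs_neq.
have hb : `|h| <= e / (`|C| + 1).
  by near: h; apply: dnbhs0_le; rewrite divr_gt0// ltr_wpDl.
rewrite /= addr0 J0 distrC.
rewrite (_ : _ - b = h^-1 * (J h - c0 - h * b)); last first.
  by rewrite /GRing.scale /= mulr1; field.
rewrite normrM normfV mulrC ler_pdivrMr ?normr_gt0//.
apply: (le_trans (hJ h)).
rewrite -(real_normK (num_real h)) expr2 mulrA ler_wpM2r//.
move: hb; rewrite ler_pdivlMr ?ltr_wpDl// => hb; apply: le_trans hb.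
by rewrite mulrC ler_wpM2l// (le_trans (ler_norm C))// lerDl ler01.
Unshelve. all: by end_near. Qed.

(** * The boundary value problem *)

Lemma cvg_mx_entries {T : Type} {R : realType} {m n} (F : set_system T) {FF : Filter F}
    (w : T -> 'M[R]_(m, n)) (l : 'M[R]_(m, n)) :
  (forall i j, w t i j @[t --> F] --> l i j) -> w t @[t --> F] --> l.
Proof.
move=> h A [P hP sPA].
have : F (fun t => forall i j, P i j (w t i j)).
  apply: filter_forall => i; apply: filter_forall => j.
  exact: (h i j _ (hP i j)).
by move=> FP; apply: (@filterS _ F FF _ (w @^-1` A) _ FP) => t Pt; exact: sPA.
Qed.

Section tail_function.
Context {R : realType}.
Variable L : R.
Hypothesis L0 : 0 < L.
Local Notation D := (`]0, L[%classic : set R).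

(** The common form of force and moment: the force p is the
    tail of f with end value F, and the moment will be the tail of the torque with
    end value 0. *)
Definition tail (h : R -> 'cV[R]_3) (c : 'cV[R]_3) (x : R) : 'cV[R]_3 := vint `]x, L[ h + c.

Lemma tailE h c x k : tail h c x k 0 = int1 `]x, L[ (fun t => h t k 0) + c k 0.
Proof. by rewrite !mxE. Qed.

Lemma tail_entry_continuous h c k : L2 L h -> {within `[0, L], continuous (fun x => tail h c x k 0)}.
Proof.
move=> hL2; have -> : (fun x => tail h c x k 0) =
    (fun x => int1 `]x, L[ (fun t => h t k 0) + c k 0).
  by apply/funext => x; rewrite tailE.
have hi : L1fun L (fun t => h t k 0) by exact: (L2fun_L1fun (hL2 k 0)).
have tc := tail_continuous L0 hi.
by move=> x; apply: cvgD; [exact: tc|exact: cvg_cst].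
Qed.

Lemma tail_continuous_mx h c : L2 L h -> {within `[0, L], continuous (tail h c)}.
Proof.
move=> hL2 x; apply: cvg_mx_entries => i j; rewrite (ord1 j).
exact: (@tail_entry_continuous h c i hL2 x).
Qed.

Lemma tail_bdd h c : L2 L h -> ess_bdd_mx L (tail h c).
Proof.
by move=> hL2 i j; rewrite (ord1 j); apply: continuous_ess_bdd; exact: tail_entry_continuous.
Qed.

Lemma tail_end h c : tail h c L = c.
Proof.
apply/colP => k; rewrite tailE /int1 set_itv_ge ?bnd_simp ?ltxx//.
by rewrite Rintegral_set0 add0r.
Qed.

(** The test function vanishes at both ends, so only the integral term of
    fubini_tail survives, and the constant c contributes nothing. *)
Lemma tail_weak_deriv h c : L2 L h -> is_weak_deriv L (tail h c) (fun t => - h t).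
Proof.
move=> hL2; apply/is_weak_derivP => k j; rewrite (ord1 j).
have hs : L2fun L (fun t => h t k 0) by exact: hL2.
have hN : (fun t => (- h t) k 0) = (fun t => - h t k 0) by apply/funext => t; rewrite mxE.
rewrite hN; split; first exact: (ess_bdd_mx_L2 (tail_bdd c hL2)); first exact: L2fun_opp.
move=> phi tphi.
have sphi : smooth_expr phi by apply: smooth_expr_smooth; case: tphi.
have [sphi' dphi] := smooth_expr_derive1 sphi.
have iphi := ess_bdd_L2fun (smooth_expr_ess_bdd L sphi).
have iphi' := ess_bdd_L2fun (smooth_expr_ess_bdd L sphi').
have phi0 : phi 0 = 0 by apply: (test_function_out tphi); rewrite /= in_itv/= ltxx.
have phiL : phi L = 0 by apply: (test_function_out tphi); rewrite /= in_itv/= ltxx andbF.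
have := fubini_tail L0 (L2fun_L1fun hs) (smooth_expr_continuous sphi') dphi.
rewrite phi0 mul0r add0r => ft.
have K := ess_bdd_L2fun (continuous_ess_bdd (tail_continuous L0 (L2fun_L1fun hs))).
have -> : (fun t => tail h c t k 0 * derive1 phi t) =
    (fun t => derive1 phi t * int1 `]t, L[ (fun t => h t k 0) + c k 0 * derive1 phi t).
  by apply/funext => t; rewrite tailE; ring.
rewrite int1_add; [|exact: L1fun_mul|exact/L1fun_scale/L2fun_L1fun].
rewrite -ft int1_scale; last exact: L2fun_L1fun.
rewrite (int1_derivative L0 (smooth_expr_continuous sphi') dphi) phi0 phiL subrr mulr0 addr0.
rewrite -int1_opp; last first.
  by have := L1fun_mul (L2fun_opp hs) iphi.
by apply: eq_Rintegral => t _; ring.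
Qed.

Lemma weak_der_eq_ae {m n} (u u' g : R -> 'M[R]_(m, n)) : L2 L u ->
  ae_on L (fun t => u t = u' t) -> is_weak_deriv L u' g -> is_weak_deriv L u g.
Proof.
move=> uL2 uu' [_ gL2 h]; split=> // phi tphi i j; rewrite -h//.
by apply: int1_ae; apply: ae_on_imp uu' => t _ ->.
Qed.

(** The primitive of a test function need not have compact support; it is an
    admissible variation vanishing at the junction and free at the other end, which
    is what yields the natural boundary condition. *)
Lemma primitive_smooth (psi : R -> R) : test_function `]0, L[ psi ->
  exists2 F, smooth_expr F & F 0 = 0 /\ derive1 F = psi.
Proof.
move=> tpsi.
have spsi : smooth_expr psi by apply: smooth_expr_smooth; case: tpsi.
have ipsi := L2fun_L1fun (ess_bdd_L2fun (smooth_expr_ess_bdd L spsi)).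
have psiE : psi \_ D = psi.
  apply/funext => t; rewrite patchE; case: ifPn => // tD.
  by rewrite (test_function_out tpsi)//; rewrite notin_setE in tD.
have iR := L1fun_patch ipsi; rewrite psiE in iR.
pose F0 (x : R) := \int[@lebesgue_measure R]_(t in `]-oo, x]) psi t.
have dF0 x : is_derive x (1 : R) F0 (psi x).
  have xx : x < x + 1 by rewrite ltrDl.
  have iy : (@lebesgue_measure R).-integrable `]-oo, (x + 1)] (EFin \o psi).
    by apply: integrableS iR.
  have [dF F'] := continuous_FTC1 xx iy (ltNyr _) (@smooth_expr_continuous _ _ spsi x).
  by apply: DeriveDef => //; rewrite -derive1E.
have dF x : is_derive x (1 : R) (fun y => F0 y + - F0 0) (psi x).
  have := is_deriveD (dF0 x) (is_derive_cst (- F0 0) x (1 : R)).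
  by rewrite addr0.
exists (fun y => F0 y + - F0 0); first exact: smooth_expr_primitive dF.
by rewrite subrr; split => //; apply/funext => x; exact: derive1_is_derive.
Qed.

End tail_function.

Section euler_lagrange.
Context {R : realType} (n : nat).
Variables (L : 'I_n -> R) (Q : 'I_n -> 'M[R]_3) (S : 'I_n -> set (R * R)).
Variables (W : 'M[R]_3 -> \bar R) (H : 'I_n -> 'M[R]_3).
Variables (p : 'I_n -> R -> 'cV[R]_3) (rot : 'I_n -> R -> 'M[R]_3) (s : 'I_n -> R -> 'cV[R]_3).
Hypothesis L0 : forall i, 0 < L i.
Hypothesis HT : forall i, (H i)^T = H i.
Hypothesis q2E : forall i a, q2 W (Q i) (S i) (axial_mx a) = dot (H i *m a) a.
Hypothesis pb : forall i, ess_bdd_mx (L i) (p i).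
Hypothesis rotW : forall i, W12_SO3 (L i) (rot i).
Hypothesis sL2 : forall i, L2 (L i) (s i).
Hypothesis sE : forall i, ae_on (L i) (fun t =>
  (rot i t)^T *m weak_deriv (L i) (rot i) t = axial_mx (s i t)).
Hypothesis st : stationary L Q W S p rot.

(** This agrees almost everywhere with the field R H R^T st of the theorem, since
    R^T R = 1 and st = R s. *)
Definition moment i t : 'cV[R]_3 := rot i t *m H i *m s i t.
Definition torque i t : 'cV[R]_3 := cross (rot i t *m e1) (p i t).

(** The vanishing first-order coefficient of the energy along rotations about e_k by
    the angles eps * phi_i. The symmetry of H and the identity
    p . (e x R e1) = e . (R e1 x p) bring it into this form. *)
Lemma weak_euler_lagrange k (phi : 'I_n -> R -> R) :
  (forall i, smooth_expr (phi i)) -> (forall i j, phi i 0 = phi j 0) ->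
  \sum_i (int1 `]0, L i[ (fun t => derive1 (phi i) t * moment i t k 0)
     - int1 `]0, L i[ (fun t => phi i t * torque i t k 0)) = 0.
Proof.
move=> sphi phi0.
have := st (fun i => smooth_exprW (delta_mx k 0 : 'cV[R]_3) (sphi i)).
have v0 i j : phi i 0 *: (delta_mx k 0 : 'cV[R]_3) = phi j 0 *: delta_mx k 0.
  by rewrite (phi0 i j).
move=> /(_ v0) dJ.
have ex i := rod_expansion (HT i) (q2E i) (rotW i) (sL2 i) (sE i) (pb i) k (sphi i).
have [c0 /choice[C hC]] := choice ex.
apply/esym; apply: (@derive_expansion _ _ (\sum_i c0 i) _ (\sum_i C i) _ _ dJ) => eps.
rewrite -[rod_energy _ _ _ _ _ _]/(\sum_i rod_functional (L i) (q2 W (Q i) (S i)) (p i)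
  (variation (rot i) k (phi i) eps)).
rewrite mulr_sumr -!sumrB mulr_suml; apply: (le_trans (ler_norm_sum _ _ _)).
by apply: ler_sum => i _; exact: hC.
Qed.

Lemma torque_bdd i : ess_bdd_mx (L i) (torque i).
Proof.
apply: ess_bdd_cross; last exact: pb.
by apply: ess_bdd_mx_mul; [exact: SO3_bdd|exact: ess_bdd_mx_cst].
Qed.

Let torqueL2 i : L2 (L i) (torque i). Proof. exact: ess_bdd_mx_L2 (torque_bdd i). Qed.

Lemma moment_L2 i : L2 (L i) (moment i).
Proof.
apply: L2_mul => //; apply: ess_bdd_mx_mul; last exact: ess_bdd_mx_cst.
exact: SO3_bdd.
Qed.

(** Varying only rod i by a primitive of a test function psi vanishing at the
    junction gives int psi moment = int F torque, which by fubini_tail is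
    int psi (tail of the torque). Since psi is arbitrary, the fundamental lemma
    identifies the moment with the tail; this contains both the differential equation
    and the vanishing of the moment at the free end. *)
Lemma moment_tail i : ae_on (L i) (fun t => moment i t = tail (L i) (torque i) 0 t).
Proof.
have : ae_on (L i) (fun t => forall k, moment i t k 0 - tail (L i) (torque i) 0 t k 0 = 0).
  apply: ae_on_forall => k.
  have tL2 := ess_bdd_mx_L2 (tail_bdd (L0 i) 0 (@torqueL2 i)).
  have dL2 : L2fun (L i) (fun t => moment i t k 0 + - tail (L i) (torque i) 0 t k 0).
    by apply: L2fun_add; [exact: moment_L2|apply: L2fun_opp; exact: tL2].
  apply: fundamental_lemma; first exact: L2fun_L1fun.
  move=> psi tpsi; have [F sF [F0 F']] := primitive_smooth tpsi.
  have spsi : smooth_expr psi by apply: smooth_expr_smooth; case: tpsi.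
  have ipsi := ess_bdd_L2fun (smooth_expr_ess_bdd (L i) spsi).
  have [_ dF] := smooth_expr_derive1 sF; rewrite F' in dF.
  (* The angles agree at 0, as required at the junction, because F 0 = 0. *)
  pose phi j := if j == i then F else cst 0.
  have sphi j : smooth_expr (phi j).
    by rewrite /phi; case: ifP => // _; exact: smooth_expr_cst.
  have phi0 j l : phi j 0 = phi l 0.
    by rewrite /phi; case: ifP => _; case: ifP => _ //=; rewrite ?F0.
  have := weak_euler_lagrange k sphi phi0.
  have z (A : set R) (g : R -> R) : (forall t, g t = 0) -> int1 A g = 0.
    move=> g0; rewrite (_ : g = cst 0); last by apply/funext.
    by rewrite /int1 /Rintegral integral0.
  rewrite (bigD1 i) //= big1 ?addr0; last first.
    move=> j /negPf ji; rewrite /phi ji.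
    rewrite z; last by move=> t; rewrite derive1_cst mul0r.
    by rewrite z ?subrr// => t; rewrite /= mul0r.
  rewrite /phi eqxx F' (fubini_tail (L0 i) (L2fun_L1fun (@torqueL2 i k 0)) (smooth_expr_continuous spsi) dF).
  rewrite F0 mul0r add0r => /eqP; rewrite subr_eq0 => /eqP h.
  have mi := L1fun_mul (moment_L2 i k 0) ipsi.
  have ti := L1fun_mul (tL2 k 0) ipsi.
  rewrite (_ : (fun t => _) = (fun t => moment i t k 0 * psi t +
     - (tail (L i) (torque i) 0 t k 0 * psi t))); last by apply/funext => t; ring.
  rewrite int1_add//; last first.
    by have := L1fun_mul (L2fun_opp (tL2 k 0)) ipsi; congr L1fun; apply/funext => t; rewrite mulNr.
  rewrite int1_opp//; apply/eqP; rewrite subr_eq0; apply/eqP.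
  rewrite (_ : (fun t => moment i t k 0 * psi t) = (fun t => psi t * moment i t k 0)); last first.
    by apply/funext => t; rewrite mulrC.
  rewrite h; apply: eq_Rintegral => t _.
  by rewrite tailE mxE addr0 mulrC.
apply: ae_on_imp => t _ h; apply/colP => k; apply/eqP; rewrite -subr_eq0; exact/eqP/h.
Qed.

(** The rigid rotation of all rods at once is an admissible variation; it leaves
    the strain unchanged, so the total torque of the load vanishes. *)
Lemma sum_torque0 : \sum_i tail (L i) (torque i) 0 0 = 0.
Proof.
apply/colP => k; rewrite summxE mxE.
have := @weak_euler_lagrange k (fun=> cst 1) (fun=> smooth_expr_cst 1) (fun _ _ => erefl).
have -> : \sum_i (int1 `]0, L i[ (fun t => derive1 (cst (1 : R)) t * moment i t k 0) -
    int1 `]0, L i[ (fun t => cst 1 t * torque i t k 0)) =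
    - \sum_i tail (L i) (torque i) 0 0 k 0.
  rewrite -sumrN; apply: eq_bigr => i _; rewrite tailE mxE addr0.
  rewrite (_ : (fun t => derive1 (cst (1 : R)) t * moment i t k 0) = cst 0); last first.
    by apply/funext => t; rewrite derive1_cst mul0r.
  rewrite {1}/int1 /Rintegral integral0 sub0r; congr (- int1 _ _).
  by apply/funext => t; rewrite mul1r.
by move/eqP; rewrite oppr_eq0 => /eqP.
Qed.

End euler_lagrange.

Theorem mainTheorem5 (R : realType) (n : nat)
    (L : 'I_n -> R) (Q : 'I_n -> 'M[R]_3) (S : 'I_n -> set (R * R))
    (W : 'M[R]_3 -> \bar R) (H : 'I_n -> 'M[R]_3)
    (f : 'I_n -> R -> 'cV[R]_3) (F : 'I_n -> 'cV[R]_3)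
    (p : 'I_n -> R -> 'cV[R]_3) (rot : 'I_n -> R -> 'M[R]_3)
    (y : 'I_n -> R -> 'cV[R]_3) (y0 : 'cV[R]_3)
    (s st q : 'I_n -> R -> 'cV[R]_3) :
  (forall i, 0 < L i) ->
  (forall i, SO3 (Q i)) ->
  (forall i, cross_section (S i)) ->
  energy_density W ->
  (forall i, [/\ (H i)^T = H i,
     forall a, a != 0 -> 0 < dot (H i *m a) a &
     forall a, q2 W (Q i) (S i) (axial_mx a) = dot (H i *m a) a]) ->
  (forall i, L2 (L i) (f i)) ->
  \sum_i (vint `]0, L i[ (f i) + F i) = 0 ->
  (forall i x, p i x = vint `]x, L i[ (f i) + F i) ->
  admissible L Q rot ->
  stationary L Q W S p rot ->
  (forall i, [/\ W12 (L i) (y i),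
     ae_on (L i) (fun t => weak_deriv (L i) (y i) t = rot i t *m e1) &
     trace (L i) (y i) 0 = y0]) ->
  (forall i, L2 (L i) (s i) /\ ae_on (L i) (fun t =>
     (rot i t)^T *m weak_deriv (L i) (rot i) t = axial_mx (s i t))) ->
  (forall i t, st i t = rot i t *m s i t) ->
  (forall i t, q i t = rot i t *m H i *m (rot i t)^T *m st i t) ->
  (forall i,
    [/\ W12 (L i) (p i),
        ae_on (L i) (fun t => weak_deriv (L i) (p i) t + f i t = 0) &
        trace (L i) (p i) (L i) = F i] /\
    [/\ W12 (L i) (q i),
        ae_on (L i) (fun t =>
          weak_deriv (L i) (q i) t + cross (rot i t *m e1) (p i t) = 0) &
        trace (L i) (q i) (L i) = 0] /\
    [/\ ae_on (L i) (fun t => q i t = rot i t *m H i *m (rot i t)^T *m st i t),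
        ae_on (L i) (fun t =>
          weak_deriv (L i) (rot i) t = axial_mx (st i t) *m rot i t) &
        ae_on (L i) (fun t => weak_deriv (L i) (y i) t = rot i t *m e1)]) /\
  [/\ \sum_i trace (L i) (p i) 0 = 0,
      \sum_i trace (L i) (q i) 0 = 0,
      forall i j, trace (L i) (rot i) 0 *m (Q i)^T =
                  trace (L j) (rot j) 0 *m (Q j)^T &
      forall i j, trace (L i) (y i) 0 = trace (L j) (y j) 0].

Proof.
move=> L0 _ _ _ hH fL2 psum0 pE [rotW rotJ] stat hy hs stE qE.
have pT i : p i = tail (L i) (f i) (F i) by apply/funext => x; rewrite pE.
have pb i : ess_bdd_mx (L i) (p i) by rewrite pT; exact: tail_bdd.
have HT i : (H i)^T = H i by have [] := hH i.
have q2E i a : q2 W (Q i) (S i) (axial_mx a) = dot (H i *m a) a by have [_ _] := hH i.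
have sL2 i : L2 (L i) (s i) by have [] := hs i.
have sE i := proj2 (hs i).
have tb i : ess_bdd_mx (L i) (torque p rot i) by exact: torque_bdd.
have mT i : ae_on (L i) (fun t => moment H rot s i t = tail (L i) (torque p rot i) 0 t).
  exact: (moment_tail L0 HT q2E pb rotW sL2 sE stat).
have sumT := sum_torque0 HT q2E pb rotW sL2 sE stat.
have SOp i t : SO3 (rot i t) -> (rot i t)^T *m rot i t = 1%:M /\ rot i t *m (rot i t)^T = 1%:M.
  by move=> [h _]; split => //; exact: mulmx1C.
(* The field q is defined everywhere, but rot is a rotation only almost everywhere. *)
have qm i : ae_on (L i) (fun t => q i t = moment H rot s i t).
  have [_ rSO] := rotW i; apply: ae_on_imp rSO => t _ /SOp[h _].
  by rewrite qE stE /moment -!mulmxA [(rot i t)^T *m _]mulmxA h mul1mx.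
have rb i := SO3_bdd (rotW i).
have qL2 i : L2 (L i) (q i).
  rewrite (_ : q i = fun t => (rot i t *m H i *m (rot i t)^T *m rot i t) *m s i t); last first.
    by apply/funext => t; rewrite qE stE !mulmxA.
  apply: L2_mul => //; apply: ess_bdd_mx_mul => //.
  apply: ess_bdd_mx_mul; last exact: ess_bdd_mx_tr.
  by apply: ess_bdd_mx_mul => //; exact: ess_bdd_mx_cst.
pose K i := tail (L i) (torque p rot i) 0.
have Kq i : ae_on (L i) (fun t => K i t = q i t).
  by have := ae_on_and (qm i) (mT i); apply: ae_on_imp => t _ [-> ->].
have Kc i : {within `[0, L i], continuous (K i)}.
  exact: tail_continuous_mx (ess_bdd_mx_L2 (tb i)).
have pc i : {within `[0, L i], continuous (p i)} by rewrite pT; exact: tail_continuous_mx.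
have in0 i : 0 \in `[0, L i] by rewrite in_itv/= lexx ltW.
have inL i : L i \in `[0, L i] by rewrite in_itv/= lexx ltW.
have qtr i x : x \in `[0, L i] -> trace (L i) (q i) x = K i x by exact: trace_eq.
have ptr i x : x \in `[0, L i] -> trace (L i) (p i) x = p i x.
  by apply: trace_eq => //; exact: ae_onT.
have pd i : is_weak_deriv (L i) (p i) (fun t => - f i t) by rewrite pT; exact: tail_weak_deriv.
have qd i : is_weak_deriv (L i) (q i) (fun t => - torque p rot i t).
  have Kd := tail_weak_deriv (L0 i) 0 (ess_bdd_mx_L2 (tb i)).
  by apply: weak_der_eq_ae Kd => //; apply: ae_on_imp (Kq i) => t _ <-.
split=> [i|]; last first.
  split=> //.
  - under eq_bigr do rewrite ptr// pE; exact: psum0.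
  - under eq_bigr do rewrite qtr//; exact: sumT.
  - by move=> i j; have [_ _ ->] := hy i; have [_ _ ->] := hy j.
split; [split|split; [split|split]].
- by exists (fun t => - f i t).
- by apply: ae_on_imp (weak_deriv_ae (pd i)) => t _ ->; rewrite addNr.
- by rewrite ptr// pT tail_end.
- by exists (fun t => - torque p rot i t).
- by apply: ae_on_imp (weak_deriv_ae (qd i)) => t _ ->; rewrite addNr.
- by rewrite qtr// /K tail_end.
- by apply: ae_onT => t _; exact: qE.
- have [_ rSO] := rotW i; have := ae_on_and rSO (sE i).
  apply: ae_on_imp => t _ [rSOt rE]; have [h h'] := SOp _ _ rSOt.
  rewrite stE.
  have -> : axial_mx (rot i t *m s i t) = rot i t *m axial_mx (s i t) *m (rot i t)^T.
    have := axial_mx_conj (rot i t *m s i t) rSOt.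
    rewrite mulmxA h mul1mx => <-.
    by rewrite !mulmxA h' mul1mx -mulmxA h' mulmx1.
  by rewrite -mulmxA h mulmx1 -rE mulmxA h' mul1mx.
- by have [] := hy i.
Qed.
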